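(* Let $p$ be a prime and let $C_1,\ldots,C_r$ be cyclic $p$-groups generated by $x_1,\ldots,x_r$ respectively, of orders $1<p^{\alpha_1}\leq\cdots\leq p^{\alpha_r}$. Let $G=C_1\amalg^{\mathfrak{N}_{p+1}}\cdots\amalg^{\mathfrak{N}_{p+1}} C_r$ be their $(p+1)$-nilpotent product. Then the center of $G$ is $Z(G)=\langle x_r^{p^{\alpha_{r-1}+1}},\,G_{p+1}\rangle$.
   Context: For groups $C_1,\dots,C_r$ and a positive integer $k$, the $k$-nilpotent product $C_1\amalg^{\mathfrak{N}_k}\cdots\amalg^{\mathfrak{N}_k}C_r$ is the quotient $F/\gamma_{k+1}(F)$ of the free product $F=C_1*\cdots*C_r$ by the $(k+1)$-st term of its lower central series. For a group $G$, $G_i$ denotes the $i$-th term of the lower central series: $G_1=G$, $G_{i+1}=[G_i,G]$. Commutators are $[a,b]=a^{-1}b^{-1}ab$. *)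

(* Defs.v *)
From mathcomp Require Import all_boot all_fingroup all_solvable.
Set Implicit Arguments. Unset Strict Implicit. Unset Printing Implicit Defensive.
Import GroupScope.
Local Open Scope group_scope.

Definition gen_by (T : finGroupType) (r : nat) (g : nat -> T) : {set T} :=
  <<[set g i.+1 | i : 'I_r]>>.

(* [is_nil_prod k G r x n]: G is the k-nilpotent product of the cyclic groups
   C_i = <x_i> of order n_i (i = 1..r), i.e. G = (C_1 * ... * C_r) / gamma_{k+1}.
   Characterised (for finite G) by its universal property in the variety N_k:
   - G is generated by x_1..x_r, x_i has order n_i;
   - G is nilpotent of class <= k, i.e. 'L_(k+1)(G) = 1 (G_{k+1} = 1);
   - for every finite group and elements y_1..y_r with y_i^(n_i) = 1 generating
     a subgroup of class <= k, there is a morphism G -> H with x_i |-> y_i. *)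
Definition is_nil_prod (gT : finGroupType) (k : nat) (G : {group gT})
    (r : nat) (x : nat -> gT) (n : nat -> nat) : Prop :=
  [/\ G :=: gen_by r x,
      forall i, 0 < i <= r -> #[x i] = n i,
      'L_k.+1(G) = 1 &
      forall (hT : finGroupType) (y : nat -> hT),
        (forall i, 0 < i <= r -> y i ^+ n i = 1) ->
        'L_k.+1(gen_by r y) = 1 ->
        exists f : {morphism G >-> hT}, forall i, 0 < i <= r -> f (x i) = y i].

(* Main.v *)
(* That x_r^(p^(a+1)), with a = alpha_(r-1), commutes with x_i follows from the
   Hall-Petrescu formula: in <x_i, x_r>, of class at most p + 1, the second term of
   the lower central series has exponent dividing p^(a+1), and the binomial
   coefficient C(p^(a+1), p), the only one below weight p + 1 not divisible by
   p^(a+1), multiplies an element of the (p+1)-st term, which has exponent p^a.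

   Conversely, x_i |-> 1 + X_i defines homomorphisms to unitriangular matrices over
   Z/p^m, one for each word u in the X_i, whose entries are the Magnus coefficients
   of the subwords of u. A central g satisfies g X_j = X_j g there. In degree 1, and
   for the word X_r^p X_(r-1), this yields the exponents of the x_i in g. In degrees
   2 <= n <= p it shows that, modulo the (n+1)-st term, the Lie polynomial of g has
   coefficients killed by the orders of the corresponding iterated commutators; the
   Dynkin operator, restricted to words starting with one chosen letter so that it
   multiplies by a number prime to p, recovers g from this polynomial and shows that
   g lies in the (n+1)-st term. For p = 2 and n = 2 the matrices lose a factor 2 and
   are replaced by a generalized dihedral group. *)

Require Import Defs.
From HB Require Import structures.
From mathcomp Require Import all_boot all_fingroup all_solvable all_algebra zify.
Set Implicit Arguments. Unset Strict Implicit. Unset Printing Implicit Defensive.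
Import GRing.Theory GroupScope.
Local Open Scope group_scope.

(** * Polynomial sequences and the Hall-Petrescu formula *)

(** The obstacle is that no basis of the factors L_n / L_(n+1) is at hand: the order of a simple
    commutator is only bounded above, by the least order of its letters. Lower bounds are never
    computed. Instead the matrices test integer coefficients modulo this same bound, and the Dynkin
    operator turns coefficients that annihilate all simple commutators into triviality of the class.
    The test groups must be finite of class at most p + 1, hence words of at most p + 1 letters over
    a finite ring; testing commutation costs one extra letter, so degrees stop at p. Modulo p^e, the
    power (1 + X_i)^(p^e) is 1 only along a word without p consecutive letters i, so the place of
    the extra letter matters. The Hall-Petrescu formula is obtained without a collection process:
    powers are polynomial sequences for the lower central filtration, such sequences form a group,
    and a Taylor expansion yields the binomial exponents. *)

Section PolynomialSequences.

Variables (gT : finGroupType) (P : nat -> {group gT}).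
Hypothesis P_decr : forall i, P i.+1 \subset P i.
Hypothesis P_comm : forall i j, [~: P i, P j] \subset P (i + j)%N.

Implicit Types f g : nat -> gT.

Definition pdiff f n := f n.+1 * (f n)^-1.
(** Polynomial sequences in the sense of Lazard and Leibman, with a shift [i] so that
    differentiation passes from degree [i] to degree [i.+1]. *)
Definition poly_seq i f := forall k n, iter k pdiff f n \in P (i + k)%N.

Lemma filtration_leq i j : i <= j -> P j \subset P i.
Proof.
elim: j => [|j IH]; first by rewrite leqn0 => /eqP->.
rewrite leq_eqVlt => /predU1P[-> //|/IH]; exact: subset_trans (P_decr j).
Qed.

Lemma eq_pdiff f g : f =1 g -> pdiff f =1 pdiff g.
Proof. by move=> eqfg n; rewrite /pdiff !eqfg. Qed.

Lemma eq_iter_pdiff k f g : f =1 g -> iter k pdiff f =1 iter k pdiff g.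
Proof. by move=> eqfg; elim: k => //= k IH; apply: eq_pdiff. Qed.

Lemma eq_poly_seq i f g : f =1 g -> poly_seq i f -> poly_seq i g.
Proof. by move=> eqfg pf k n; rewrite -(eq_iter_pdiff k eqfg). Qed.

Lemma poly_seqS i f :
  poly_seq i f <-> (forall n, f n \in P i) /\ poly_seq i.+1 (pdiff f).
Proof.
split=> [pf | [f0 pf]].
  split=> [n | k n]; first by have := pf 0 n; rewrite addn0.
  by rewrite -iterSr addSnnS; apply: pf.
case=> [|k] n; first by rewrite addn0; apply: f0.
by rewrite iterSr -addSnnS; apply: pf.
Qed.

Lemma poly_seq_leq i j f : i <= j -> poly_seq j f -> poly_seq i f.
Proof.
move=> leij pf k n; apply: subsetP (pf k n).
by apply: filtration_leq; rewrite leq_add2r.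
Qed.

Lemma poly_seq_const i x : x \in P i -> poly_seq i (fun=> x).
Proof.
move=> Px; case=> [|k] n; first by rewrite addn0.
suff ->: iter k.+1 pdiff (fun=> x) n = 1 by [].
elim: k n => [|k IH] n; first by rewrite /= /pdiff mulgV.
by rewrite iterS /pdiff !IH mulgV.
Qed.

Variable K : nat.
Hypothesis P_last : P K = 1%G.

Lemma filtration_triv i : K <= i -> P i = 1%G.
Proof.
move=> leKi; apply/val_inj/trivgP.
by have := filtration_leq leKi; rewrite P_last.
Qed.

Lemma poly_seq_triv i f : K <= i -> (forall n, f n = 1) -> poly_seq i f.
Proof.
move=> leKi f1; apply: eq_poly_seq (_ : poly_seq i (fun=> 1)) => //.
exact: poly_seq_const.
Qed.

Lemma poly_seq_ge i f : K <= i -> poly_seq i f -> forall n, f n = 1.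
Proof.
move=> leKi /poly_seqS[f1 _] n; apply/set1gP.
by have := f1 n; rewrite filtration_triv.
Qed.

Let comm_closed d := forall i j f g, d <= i + j ->
  poly_seq i f -> poly_seq j g -> poly_seq (i + j) (fun n => [~ f n, g n]).

Let mul_closed i := forall f g,
  poly_seq i f -> poly_seq i g -> poly_seq i (fun n => f n * g n).

Lemma poly_seq_conj_of_comm i j f g : comm_closed i -> mul_closed i ->
  poly_seq i f -> poly_seq j g -> poly_seq i (fun n => f n ^ g n).
Proof.
move=> cB cA pf pg.
apply: eq_poly_seq (_ : poly_seq i (fun n => f n * [~ f n, g n])).
  by move=> n; rewrite -conjg_mulR.
apply: cA => //; apply: (@poly_seq_leq _ (i + j)); first exact: leq_addr.
by apply: cB; rewrite ?leq_addr.
Qed.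

(** Turns inverses into positive powers, so that closure under inverses and under conjugation by
    inverses follows by induction from products and conjugation. *)
Lemma invg_expg (x : gT) : x^-1 = x ^+ #|gT|.-1.
Proof.
apply/eqP; rewrite eq_invg_mul -expgS prednK -?cardsT; last exact: cardG_gt0.
by apply/eqP/expg_cardG; rewrite inE.
Qed.

Lemma poly_seq_conjV_of_comm i j f g : comm_closed i -> mul_closed i ->
  poly_seq i f -> poly_seq j g -> poly_seq i (fun n => f n ^ (g n)^-1).
Proof.
move=> cB cA pf pg.
apply: eq_poly_seq (_ : poly_seq i (fun n => f n ^ (g n ^+ #|gT|.-1))).
  by move=> n; rewrite -invg_expg.
elim: _.-1 => [|m IH]; first by apply: eq_poly_seq pf => n; rewrite conjg1.
apply: eq_poly_seq (_ : poly_seq i (fun n => (f n ^ (g n ^+ m)) ^ g n)).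
  by move=> n; rewrite expgSr conjgM.
exact: poly_seq_conj_of_comm pg.
Qed.

(* Products in degree i only need commutators in degrees > i, and commutators in
   total degree d (below) only need products and commutators in degrees > d: hence
   the descending inductions. *)
Lemma poly_seq_mul_of_comm i : comm_closed i.+1 -> mul_closed i.
Proof.
move def_m: (K - i) => m; elim: m i def_m => [|m IH] i def_m cB f g pf pg.
  have leKi: K <= i by rewrite -subn_eq0 def_m.
  apply: poly_seq_triv => // n.
  by rewrite (poly_seq_ge leKi pf) (poly_seq_ge leKi pg) mulg1.
have cA : mul_closed i.+1.
  by apply: IH => [|j k u v ltij]; [rewrite subnS def_m | apply: cB; apply: ltnW].
case/poly_seqS: (pf) => f0 df; case/poly_seqS: (pg) => g0 dg.
apply/poly_seqS; split=> [n|]; first by rewrite groupM.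
(* Product rule. Conjugating [pdiff g] by [f] costs only commutators of total degree above [i],
   which [cB] controls. *)
apply: eq_poly_seq (_ : poly_seq i.+1
  (fun n => pdiff f n * pdiff g n ^ (f n)^-1)).
  by move=> n; rewrite /pdiff conjgE; rewrite !gnorm.
apply: (cA) => //; exact: (poly_seq_conjV_of_comm cB cA dg pf).
Qed.

Lemma poly_seq_comm_closed d : comm_closed d.
Proof.
move def_m: (K - d) => m; elim: m d def_m => [|m IH] d def_m.
  have leKd: K <= d by rewrite -subn_eq0 def_m.
  move=> i j f g ledij pf pg; apply: poly_seq_triv; first exact: leq_trans ledij.
  move=> n; apply/set1gP; have := P_comm i j; rewrite (filtration_triv (leq_trans leKd ledij)).
  by move/subsetP; apply; rewrite mem_commg //; [case/poly_seqS: pf | case/poly_seqS: pg].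
have cB : comm_closed d.+1 by apply: IH; rewrite subnS def_m.
move=> i j f g; rewrite leq_eqVlt.
case/predU1P=> [def_d | ltdij] pf pg; last exact: cB.
have cA : mul_closed d.+1.
  by apply: poly_seq_mul_of_comm => a b u v ltab; apply: cB; apply: ltnW.
have cJ := poly_seq_conj_of_comm cB cA; have cJV := poly_seq_conjV_of_comm cB cA.
case/poly_seqS: (pf) => f0 df; case/poly_seqS: (pg) => g0 dg.
apply/poly_seqS; split=> [n|]; first by rewrite (subsetP (P_comm i j)) // mem_commg.
have pSf : poly_seq i (fun n => f n.+1).
  move=> k n; suff ->: iter k pdiff (fun n => f n.+1) n = iter k pdiff f n.+1 by [].
  by elim: k n => //= k IHk n; rewrite /pdiff !IHk.
rewrite -def_d.
(* Leibniz rule for commutators: up to conjugation, both factors are commutators of total degree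
   [d.+1], one of them with the shifted sequence of [pSf]. *)
apply: eq_poly_seq (_ : poly_seq d.+1 (fun n => [~ pdiff f n, g n] ^ f n *
    (([~ f n.+1, pdiff g n] ^ (f n)^-1) ^ g n) ^ f n)).
  by move=> n; rewrite /pdiff !commgEl !conjgE; rewrite !gnorm.
apply: cA.
  by apply: cJ pf; rewrite def_d -addSn; apply: cB => //; rewrite def_d addSn.
apply: (cJ) (pf); apply: (cJ) (pg); apply: (cJV) (pf).
by rewrite def_d -addnS; apply: cB => //; rewrite def_d addnS.
Qed.

Lemma poly_seq_mul i f g :
  poly_seq i f -> poly_seq i g -> poly_seq i (fun n => f n * g n).
Proof. exact/poly_seq_mul_of_comm/poly_seq_comm_closed. Qed.

Lemma poly_seq_inv i f : poly_seq i f -> poly_seq i (fun n => (f n)^-1).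
Proof.
move=> pf; apply: eq_poly_seq (_ : poly_seq i (fun n => f n ^+ #|gT|.-1)).
  by move=> n; rewrite -invg_expg.
elim: _.-1 => [|m IH]; first exact: poly_seq_const.
apply: eq_poly_seq (_ : poly_seq i (fun n => f n * f n ^+ m)).
  by move=> n; rewrite expgS.
exact: poly_seq_mul.
Qed.

Lemma poly_seq_binomial i k x :
  x \in P (i + k)%N -> poly_seq i (fun n => x ^+ 'C(n, k)).
Proof.
elim: k i => [|k IH] i Px.
  apply: eq_poly_seq (_ : poly_seq i (fun=> x)) => [n|]; first by rewrite bin0.
  by apply: poly_seq_const; rewrite addn0 in Px.
apply/poly_seqS; split=> [n|].
  by rewrite groupX // (subsetP (filtration_leq _) _ Px) ?leq_addr.
apply: eq_poly_seq (_ : poly_seq i.+1 (fun n => x ^+ 'C(n, k))) => [n|].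
  by rewrite /pdiff binS addnC expgD mulgK.
by apply: IH; rewrite addSnnS.
Qed.

(** The first possibly nontrivial value is an iterated derivative at 0; this is what places the
    Taylor coefficients in the right terms of the filtration. *)
Lemma iter_pdiff_vanish k f : (forall n, n < k -> f n = 1) ->
  iter k pdiff f 0 = f k.
Proof.
move=> f0; suff dvan: forall j, j <= k -> (forall n, n + j < k -> iter j pdiff f n = 1)
    /\ iter j pdiff f (k - j) = f k.
  by case: (dvan k (leqnn k)); rewrite subnn.
elim=> [|j IH] ltjk; first by split=> [n|]; rewrite ?addn0 ?subn0 => //; apply: f0.
have [van last] := IH (ltnW ltjk); split=> [n lt_njk | ].
  rewrite iterS /pdiff !van ?mulgV ?addSnnS //.
  by apply: leq_ltn_trans lt_njk; rewrite leq_add2l.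
rewrite iterS /pdiff -subSn // subSS last van ?invg1 ?mulg1 //.
by rewrite -addnS subnK.
Qed.

(** Newton interpolation: dividing by [f m ^+ 'C(n, m)] kills the value at [m] and leaves the
    earlier ones trivial. The bound [maxn m K] makes the product empty once [m] reaches [K], where
    the induction on [K - m] starts. *)
Lemma poly_seq_Taylor f : poly_seq 0 f ->
  forall m, (forall n, n < m -> f n = 1) ->
  exists2 c : nat -> gT, (forall k, c k \in P k)
    & forall n, f n = \prod_(m <= k < maxn m K) c k ^+ 'C(n, k).
Proof.
move=> pf m; move def_d: (K - m) => d; elim: d m f pf def_d => [|d IH] m f pf def_d f0.
  have leKm : K <= m by rewrite -subn_eq0 def_d.
  exists (fun=> 1) => [k|n]; first exact: group1.
  rewrite (maxn_idPl leKm) big_geq //.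
  elim/ltn_ind: n => n IHn; have [/f0 // | lemn] := ltnP n m.
  rewrite -(iter_pdiff_vanish IHn); apply/set1gP.
  by have := pf n 0; rewrite add0n filtration_triv // (leq_trans leKm).
have ltmK : m < K by rewrite -subn_gt0 def_d.
pose x := f m; have Px : x \in P m.
  by rewrite /x -(iter_pdiff_vanish f0); apply: pf.
have pg : poly_seq 0 (fun n => (x ^+ 'C(n, m))^-1 * f n).
  by apply: poly_seq_mul => //; apply/poly_seq_inv/poly_seq_binomial.
have [||c Pc def_g] := IH m.+1 _ pg; first by rewrite subnS def_d.
  move=> n; rewrite ltnS leq_eqVlt => /predU1P[-> | ltnm].
    by rewrite binn expg1 mulVg.
  by rewrite bin_small // f0 // invg1 mulg1.
exists (fun k => if k == m then x else c k) => [k | n]; first by case: eqP => [->|].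
rewrite (maxn_idPr (ltnW ltmK)) big_ltn // eqxx.
rewrite (maxn_idPr ltmK) in def_g; apply: (canRL (mulKVg _)); rewrite def_g.
by apply: eq_big_nat => k /andP[ltmk _]; rewrite gtn_eqF.
Qed.

End PolynomialSequences.

Lemma lcn_comm (gT : finGroupType) (G : {group gT}) i j :
  0 < i -> 0 < j -> [~: 'L_i(G), 'L_j(G)] \subset 'L_(i + j)(G).
Proof.
case: i j => // i [//|j] _ _; elim: j i => [|j IH] i.
  by rewrite addn1 lcn1; apply: lcnSnS.
have nL k (A : {set gT}) : A \subset G -> A \subset 'N('L_k(G)).
  by move=> sAG; exact: subset_trans sAG (lcn_norm k G).
have sLG k : 'L_k(G) \subset G by apply: lcn_sub.
have sRG (A B : {set gT}) : A \subset G -> B \subset G -> [~: A, B] \subset G.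
  by move=> sA sB; rewrite (subset_trans (commgSS sA sB)) // commg_subr normG.
rewrite [X in [~: _, X]]lcnSn commGC.
set N := 'L_(i.+1 + j.+2)(G).
(* The three subgroup lemma speaks of trivial commutators, so it is applied modulo [N]. *)
suff qR1 : [~: 'L_j.+1(G) / N, G / N, 'L_i.+1(G) / N] = 1.
  by rewrite -!quotientR ?nL ?sRG // in qR1; rewrite -quotient_sub1 ?nL ?sRG ?qR1.
have q1 (A : {group gT}) : A \subset N -> A / N = 1.
  by move=> sAN; apply/trivgP; rewrite quotient_sub1 // (subset_trans sAN) ?normG.
apply: three_subgroup; rewrite -!quotientR ?nL ?sRG ?sLG //.
  apply: (q1 [~: [~: G, 'L_i.+1(G)], 'L_j.+1(G)]%G) => /=.
  have ->: [~: G, 'L_i.+1(G)] = 'L_i.+2(G) by rewrite commGC.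
  by rewrite /N addnS -addSn; apply: IH.
apply: (q1 [~: [~: 'L_i.+1(G), 'L_j.+1(G)], G]%G) => /=.
by rewrite /N addnS; apply: subset_trans (lcnSnS _ _); apply/commSg/IH.
Qed.

(** The sequence (x^n y^n)^-1 (x y)^n is polynomial and trivial at n = 0 and n = 1, so its Taylor
    expansion starts at k = 2. *)
Lemma hall_petrescu (gT : finGroupType) (G : {group gT}) (K : nat) (x y : gT) :
  0 < K -> 'L_K(G) = 1 -> x \in G -> y \in G ->
  exists2 c : nat -> gT, (forall k, c k \in 'L_k(G))
    & forall n, (x * y) ^+ n = x ^+ n * y ^+ n * \prod_(2 <= k < maxn 2 K) c k ^+ 'C(n, k).
Proof.
move=> K_gt0 LK Gx Gy; pose P k := 'L_k(G)%G.
have P_decr i : P i.+1 \subset P i by apply: lcn_subS.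
have P_comm i j : [~: P i, P j] \subset P (i + j)%N.
  case: i j => [|i] [|j]; rewrite ?addn0; last exact: lcn_comm.
  - by rewrite comm_subG.
  - by rewrite add0n /= lcn0 commg_subr lcn_norm.
  by rewrite /= lcn0 commg_subl lcn_norm.
have P_last : P K = 1%G by apply/val_inj.
have px z : z \in G -> poly_seq P 0 (fun n => z ^+ n).
  move=> Gz; apply: eq_poly_seq (_ : poly_seq P 0 (fun n => z ^+ 'C(n, 1))).
    by move=> n; rewrite bin1.
  by apply: (poly_seq_binomial P_decr).
have pf : poly_seq P 0 (fun n => (x ^+ n * y ^+ n)^-1 * (x * y) ^+ n).
  have pM := poly_seq_mul P_decr P_comm P_last.
  apply: (pM); last by apply/px/groupM.
  by apply: (poly_seq_inv P_decr P_comm P_last); apply: pM; apply: px.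
have [|c Lc def_f] := poly_seq_Taylor P_decr P_comm P_last pf (m := 2).
  by case=> [|[|]] // _; rewrite ?expg0 ?expg1 ?mulg1 ?invg1 ?mulVg.
by exists c => // n; rewrite -def_f mulKVg.
Qed.

(** * Powers of generators and commutation *)

Lemma dvdn_bin_pexp p e k : prime p -> 0 < k < p -> p ^ e %| 'C(p ^ e, k).
Proof.
move=> p_pr /andP[k_gt0 ltkp].
have co_k : coprime (p ^ e) k.
  by rewrite coprimeXl // prime_coprime // gtnNdvd.
rewrite -(Gauss_dvdr _ co_k); case: k k_gt0 {ltkp co_k} => // k _.
by rewrite -mul_bin_diag dvdn_mulr.
Qed.

Lemma dvdn_bin_pexp_p p e : prime p -> p ^ e %| 'C(p ^ e.+1, p).
Proof.
move=> p_pr; rewrite -(dvdn_pmul2l (prime_gt0 p_pr)) -expnS.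
by rewrite -[X in _ %| X * 'C(_, X)](prednK (prime_gt0 p_pr)) -mul_bin_diag dvdn_mulr.
Qed.

Section LcnPowers.

Variables (gT : finGroupType) (G : {group gT}).

Lemma lcn_lcn j k : 0 < j -> 0 < k -> 'L_k('L_j(G)) \subset 'L_(j * k)(G).
Proof.
move=> j_gt0; case: k => // k _; elim: k => [|k IH]; first by rewrite muln1 lcn1.
rewrite lcnSn mulnS addnC; apply: subset_trans (commgSS IH (subxx _)) _.
by apply: lcn_comm; rewrite ?muln_gt0 ?j_gt0.
Qed.

(** One step is gained over [lcn_lcn]: powers of [h] commute with each other, so every commutator
    has an entry in ['L_j.+1(G)]. *)
Lemma lcn_cycle_join j k h : 0 < j -> 1 < k -> h \in 'L_j(G) ->
  'L_k(<[h]> <*> 'L_j.+1(G)) \subset 'L_(j * k).+1(G).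
Proof.
move=> j_gt0; case: k => [|[|k]] // _ Lh; elim: k => [|k IH].
  have sK : <[h]> <*> 'L_j.+1(G) \subset G.
    by rewrite join_subG lcn_sub cycle_subG (subsetP (lcn_sub j G)).
  have nL : <[h]> <*> 'L_j.+1(G) \subset 'N('L_(j * 2).+1(G)).
    exact: subset_trans sK (lcn_norm _ _).
  rewrite lcn2; apply: der1_min => //.
  rewrite quotientY ?(subset_trans (joing_subl _ _) nL) ?(subset_trans (joing_subr _ _) nL) //.
  rewrite abelianY quotient_abelian ?cycle_abelian //=.
  rewrite /abelian !quotient_cents2r //.
    rewrite /= muln2 -addnn -addSn.
    apply: subset_trans (lcn_comm G (ltn0Sn j) j_gt0).
    by apply: commgSS; rewrite // cycle_subG.
  apply: subset_trans (lcn_comm G (ltn0Sn j) (ltn0Sn j)) (lcn_sub_leq G _).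
  by rewrite muln2 -addnn addSn ltnS leq_add2l.
rewrite lcnSn mulnS addnC -addSn.
apply: subset_trans (commgSS IH _) (lcn_comm G (ltn0Sn _) j_gt0).
by rewrite join_subG lcn_subS cycle_subG Lh.
Qed.

Variable K : nat.
Hypothesis LK : 'L_K.+2(G) = 1.

Lemma expMg_lcn j u v : 0 < j -> u \in 'L_j(G) -> v \in 'L_j(G) ->
  exists2 c : nat -> gT, (forall k, 1 < k -> c k \in 'L_(j * k)(G)) &
    forall n, (u * v) ^+ n = u ^+ n * v ^+ n * \prod_(2 <= k < K.+2) c k ^+ 'C(n, k).
Proof.
move=> j_gt0 Lu Lv; have LK1 : 'L_K.+2('L_j(G)) = 1.
  by apply/trivgP; rewrite -LK lcnS ?lcn_sub.
have [|c Lc def_c] := hall_petrescu _ LK1 Lu Lv => //.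
exists c => [k k_gt1 | n]; last by rewrite def_c (maxn_idPr _).
exact: (subsetP (lcn_lcn j_gt0 (ltnW k_gt1))) (Lc k).
Qed.

(** Since [h^n, g] = h^-n (h [h, g])^n, the Hall-Petrescu formula can be used inside [H], where
    [lcn_cycle_join] gains one in the weight of each [c k]. *)
Lemma commXg_lcn j h g : 0 < j -> h \in 'L_j(G) -> g \in G ->
  exists2 c : nat -> gT, (forall k, 1 < k -> c k \in 'L_(j * k).+1(G)) &
    forall n, [~ h ^+ n, g] = [~ h, g] ^+ n * \prod_(2 <= k < K.+2) c k ^+ 'C(n, k).
Proof.
move=> j_gt0 Lh Gg; pose H := <[h]> <*> 'L_j.+1(G).
have sHG : H \subset G.
  by rewrite join_subG lcn_sub cycle_subG (subsetP (lcn_sub j G)).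
have LK1 : 'L_K.+2(H) = 1 by apply/trivgP; rewrite -LK lcnS.
have Hh : h \in H by rewrite mem_gen // inE cycle_id.
have Hc : [~ h, g] \in H.
  by rewrite mem_gen // inE (subsetP (lcnSnS _ _)) ?mem_commg ?orbT.
have [|c Lc def_c] := hall_petrescu _ LK1 Hh Hc => //.
exists c => [k k_gt1 | n]; first exact: (subsetP (lcn_cycle_join j_gt0 k_gt1 Lh)) (Lc k).
by rewrite commgEl conjXg conjg_mulR def_c -mulgA mulKg (maxn_idPr _).
Qed.

End LcnPowers.

Section CommutingPowers.

Variables (gT : finGroupType) (G : {group gT}) (p a : nat) (y z : gT).
Hypotheses (p_pr : prime p) (Gyz : G :=: <[y]> <*> <[z]>).
Hypotheses (Lp2 : 'L_p.+2(G) = 1) (y_exp : y ^+ (p ^ a) = 1).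

Let m := (p ^ a)%N.
Let n := (p ^ a.+1)%N.

Let Gy : y \in G. Proof. by rewrite Gyz mem_gen // inE cycle_id. Qed.
Let Gz : z \in G. Proof. by rewrite Gyz mem_gen // inE cycle_id orbT. Qed.

Lemma lcn2_sub_of_comm (W : {group gT}) :
  G \subset 'N(W) -> [~ y, z] \in W -> 'L_2(G) \subset W.
Proof.
move=> nWG Wyz; rewrite lcn2; apply: der1_min => //; rewrite Gyz.
have nWy : <[y]> \subset 'N(W) by rewrite cycle_subG (subsetP nWG).
have nWz : <[z]> \subset 'N(W) by rewrite cycle_subG (subsetP nWG).
rewrite quotientY // abelianY !quotient_abelian ?cycle_abelian //=.
rewrite !quotient_cycle -?cycle_subG // cent_cycle cycle_subG; apply/cent1P.
apply/commgP; rewrite -morphR -?cycle_subG //; apply/eqP/coset_id.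
by rewrite -invg_comm groupV.
Qed.

Lemma lcn_sub_of_comm j (W : {group gT}) :
  (forall h g, h \in 'L_j.+1(G) -> g \in G -> [~ h, g] \in W) -> 'L_j.+2(G) \subset W.
Proof.
by move=> cW; rewrite lcnSn gen_subG; apply/subsetP=> _ /imset2P[h g Lh Gg ->]; apply: cW.
Qed.

(** Allows statements on e-th powers to be checked on generators only: where the power map is
    multiplicative modulo [W], the elements sent into [W] form a subgroup. *)
Lemma pow_subgroup (A W : {group gT}) e :
    (forall u v, u \in A -> v \in A -> (u * v) ^+ e \in u ^+ e * v ^+ e *: W) ->
    A <| G -> G \subset 'N(W) ->
  exists2 B : {group gT}, G \subset 'N(B) & forall u, (u \in B) = (u \in A) && (u ^+ e \in W).
Proof.
move=> eM /andP[sAG nAG] nWG; pose B := [set u in A | u ^+ e \in W].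
have gB : group_set B.
  apply/group_setP; split=> [|u v]; rewrite !inE ?group1 ?expg1n ?group1 //.
  case/andP=> Au Wu /andP[Av Wv]; rewrite groupM //=.
  by have /lcosetP[w Ww ->] := eM u v Au Av; rewrite !groupM.
exists (Group gB) => [|u]; last by rewrite inE.
apply/subsetP=> g Gg; rewrite inE; apply/subsetP=> _ /imsetP[u /= Bu ->].
move: Bu; rewrite !inE => /andP[Au Wu].
by rewrite -conjXg !memJ_norm ?Au ?(subsetP nAG) ?(subsetP nWG).
Qed.

(** For h of weight i, [h, g]^m agrees with [h^m, g] modulo weight i + 2. The exponent of [y] thus
    passes to [y, z], and from there down the series. *)
Lemma pow_lcn_step j u : 1 < j -> u \in 'L_j(G) -> u ^+ m \in 'L_j.+1(G).
Proof.
suff {u}: 1 < j -> exists2 B : {group gT}, 'L_j(G) \subset B &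
    forall u, (u \in B) = (u \in 'L_j(G)) && (u ^+ m \in 'L_j.+1(G)).
  by move=> sub /sub[B sLB defB] Lu; have := subsetP sLB u Lu; rewrite defB => /andP[].
have powM i (u v : gT) : 0 < i -> u \in 'L_i(G) -> v \in 'L_i(G) ->
    (u * v) ^+ m \in u ^+ m * v ^+ m *: 'L_i.+1(G).
  move=> i_gt0 Lu Lv; have [c Lc ->] := expMg_lcn Lp2 i_gt0 Lu Lv.
  rewrite mem_lcoset mulKg big_nat; apply: group_prod => k /andP[k_gt1 _].
  apply/groupX/(subsetP _ _ (Lc k k_gt1))/lcn_sub_leq.
  by rewrite -addn1 (leq_trans _ (leq_mul (leqnn i) k_gt1)) // muln2 -addnn leq_add2l.
have ex i : 0 < i -> exists2 B : {group gT}, G \subset 'N(B) &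
    forall u, (u \in B) = (u \in 'L_i(G)) && (u ^+ m \in 'L_i.+1(G)).
  move=> i_gt0; apply: (@pow_subgroup 'L_i(G)%G 'L_i.+1(G)%G m); rewrite /= ?lcn_normal ?lcn_norm //.
  by move=> u v; apply: powM.
have tailL i h g : 0 < i -> h \in 'L_i(G) -> g \in G -> [~ h ^+ m, g] \in 'L_i.+2(G) ->
    [~ h, g] ^+ m \in 'L_i.+2(G).
  move=> i_gt0 Lh Gg; have [c Lc ->] := commXg_lcn Lp2 i_gt0 Lh Gg.
  rewrite groupMr // big_nat; apply: group_prod => k /andP[k_gt1 _].
  apply/groupX/(subsetP _ _ (Lc k k_gt1))/lcn_sub_leq.
  by rewrite ltnS -addn1 (leq_trans _ (leq_mul (leqnn i) k_gt1)) // muln2 -addnn leq_add2l.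
case: j => [|[|j]] // _; elim: j => [|j IH].
  have [B nB defB] := ex 2 isT; exists B => //; apply: lcn2_sub_of_comm => //.
  rewrite defB lcn2 mem_commg //= tailL ?lcn1 //.
  by rewrite /m y_exp comm1g group1.
have [B nB defB] := ex j.+3 isT; exists B => //; apply: lcn_sub_of_comm => h g Lh Gg.
rewrite defB lcnSn mem_commg //= tailL // lcnSn mem_commg //.
by case: IH => C sLC defC; have := subsetP sLC h Lh; rewrite defC => /andP[].
Qed.

Lemma pow_lcn_last u : u \in 'L_p.+1(G) -> u ^+ m = 1.
Proof.
move=> Lu; apply/set1gP; rewrite -Lp2; apply: pow_lcn_step => //.
by rewrite ltnS prime_gt0.
Qed.

Lemma hall_tail (W : {group gT}) (c : nat -> gT) :
    (forall k, 1 < k < p -> c k ^+ n \in W) -> c p ^+ m \in W -> c p.+1 \in W ->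
  \prod_(2 <= k < p.+2) c k ^+ 'C(n, k) \in W.
Proof.
move=> Wc Wp Wp1; rewrite big_nat; apply: group_prod => k /andP[k_gt1].
rewrite ltnS leq_eqVlt ltnS leq_eqVlt => /or3P[/eqP-> | /eqP-> | ltkp].
- exact: groupX.
- by have /dvdnP[q ->] := dvdn_bin_pexp_p a p_pr; rewrite mulnC expgM groupX.
have /dvdnP[q ->] : n %| 'C(n, k) by rewrite dvdn_bin_pexp ?ltkp ?(ltnW k_gt1).
by rewrite mulnC expgM groupX // Wc // k_gt1.
Qed.

Let V j : {set gT} := <<[set u ^+ n | u in 'L_j(G)]>>.

Lemma mem_powers j u : u \in 'L_j(G) -> u ^+ n \in V j.
Proof. by move=> Lu; apply/mem_gen/imset_f. Qed.

Lemma powers_norm j : G \subset 'N(V j).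
Proof.
apply: norms_gen; apply/subsetP=> g Gg; rewrite inE.
apply/subsetP=> _ /imsetP[_ /imsetP[u Lu ->] ->]; apply/imsetP; exists (u ^ g).
  by rewrite memJ_norm // (subsetP (lcn_norm j G)).
by rewrite conjXg.
Qed.

Lemma mem_powers_leq i j u : i <= j -> u \in 'L_j(G) -> u ^+ n \in V i.
Proof. by move=> leij Lu; apply: mem_powers; apply: subsetP (lcn_sub_leq G leij) _ Lu. Qed.

Lemma lcn_mem_triv i u : p.+2 <= i -> u \in 'L_i(G) -> u = 1.
Proof.
by move=> lei Lu; apply/set1gP; rewrite -Lp2; apply: subsetP (lcn_sub_leq G lei) _ Lu.
Qed.

Lemma powers_comm i : 1 < i -> [~: V i, G] \subset V i.+1.
Proof.
move=> i_gt1; have i_gt0 := ltnW i_gt1.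
have sVG : [set u ^+ n | u in 'L_i(G)] \subset G.
  by apply/subsetP=> _ /imsetP[u Lu ->]; rewrite groupX // (subsetP (lcn_sub i G)).
have nV := powers_norm i.+1.
have nS := subset_trans sVG nV.
rewrite -quotient_cents2 ?gen_subG // quotient_gen // gen_subG quotient_cents2 // gen_subG.
apply/subsetP=> _ /imset2P[_ g /imsetP[u Lu ->] Gg ->].
have [c Lc ->] := commXg_lcn Lp2 i_gt0 Lu Gg; rewrite groupM //.
  by apply: mem_powers; rewrite (subsetP (lcnSnS _ _)) ?mem_commg.
(* As i is at least 2, the factors with k at least p have weight at least 2p + 1, beyond the
   class. *)
have big k : p <= k -> p.+1 < (i * k).+1.
  move=> lepk; rewrite ltnS (leq_trans _ (leq_mul i_gt1 lepk)) // mul2n -addnn.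
  by rewrite -addn1 leq_add2l prime_gt0.
apply: (@hall_tail (<<[set u ^+ n | u in 'L_i.+1(G)]>>)%G c) => [k /andP[k_gt1 _]||] /=.
- apply: (mem_powers_leq _ (Lc k k_gt1)); rewrite ltnS.
  by rewrite leq_pmulr // ltnW.
- by rewrite (lcn_mem_triv _ (Lc p (prime_gt1 p_pr))) ?big // expg1n.
by rewrite (lcn_mem_triv _ (Lc p.+1 _)) ?big // ltnS prime_gt0.
Qed.

Lemma powers_subgroup j : 1 < j -> exists2 B : {group gT}, G \subset 'N(B) &
  forall u, (u \in B) = (u \in 'L_j(G)) && (u ^+ n \in V j.+1).
Proof.
move=> j_gt1; have j_gt0 := ltnW j_gt1.
apply: (@pow_subgroup 'L_j(G)%G (<<[set u ^+ n | u in 'L_j.+1(G)]>>)%G n);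
  rewrite /= ?lcn_normal ?powers_norm //.
move=> u v Lu Lv; have [c Lc ->] := expMg_lcn Lp2 j_gt0 Lu Lv.
rewrite mem_lcoset mulKg.
have big k : p <= k -> p.+1 < j * k.
  move=> lepk; rewrite (leq_trans _ (leq_mul j_gt1 lepk)) // mul2n -addnn.
  by rewrite -addn2 leq_add2l prime_gt1.
apply: (@hall_tail (<<[set u ^+ n | u in 'L_j.+1(G)]>>)%G c) => [k /andP[k_gt1 _]||] /=.
- apply: (mem_powers_leq _ (Lc k k_gt1)).
  by rewrite -addn1 (leq_trans _ (leq_mul (leqnn j) k_gt1)) // muln2 -addnn leq_add2l.
- by rewrite (lcn_mem_triv _ (Lc p (prime_gt1 p_pr))) ?big // expg1n.
by rewrite (lcn_mem_triv _ (Lc p.+1 _)) ?big // ltnS prime_gt0.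
Qed.

Lemma powers_subS j : 1 < j ->
  (forall B : {group gT}, G \subset 'N(B) ->
    (forall u, (u \in B) = (u \in 'L_j(G)) && (u ^+ n \in V j.+1)) -> 'L_j(G) \subset B) ->
  V j \subset V j.+1.
Proof.
move=> j_gt1 sub; have [B nB defB] := powers_subgroup j_gt1.
rewrite gen_subG; apply/subsetP=> _ /imsetP[u Lu ->].
by have := subsetP (sub B nB defB) u Lu; rewrite defB => /andP[].
Qed.

(* The groups [V j] generated by the [n]-th powers of [L_j] satisfy
   [V j.+2 <= V j.+3], hence are trivial for [j >= 2]. *)
Lemma lcn2_exponent u : u \in 'L_2(G) -> u ^+ n = 1.
Proof.
have step j : V j.+2 \subset V j.+3.
  elim: j => [|j IH]; apply: powers_subS => // B nB defB.
    apply: lcn2_sub_of_comm => //; rewrite defB lcn2 mem_commg //=.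
    (* Here [y^n, z] = 1, so [y, z]^n is the inverse of the tail. In this weight the factor k = p
       need not vanish; the step gained in [lcn_cycle_join] puts it in the term p + 1, of exponent
       p^a. *)
    have [|c Lc /(_ n)] := @commXg_lcn _ _ _ Lp2 1 y z _ Gy Gz => //.
    have -> : y ^+ n = 1 by rewrite /n expnSr expgM y_exp expg1n.
    rewrite comm1g => /esym/eqP.
    rewrite -eq_invg_mul => /eqP def_c; rewrite -groupV def_c.
    apply: (@hall_tail (<<[set u ^+ n | u in 'L_3(G)]>>)%G c) => [k /andP[k_gt1 _]||] /=.
    - by apply: mem_powers_leq (Lc k k_gt1); rewrite mul1n.
    - by rewrite pow_lcn_last // -[p in 'L_p.+1(_)]mul1n Lc ?prime_gt1.
    by rewrite (lcn_mem_triv _ (Lc p.+1 _)) ?mul1n // ltnS prime_gt0.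
  apply: lcn_sub_of_comm => h g Lh Gg; rewrite defB lcnSn mem_commg //=.
  (* The induction hypothesis puts [h ^+ n] one term deeper, so that its commutator with [g] reaches
     [V j.+4]. *)
  have [|c Lc /(_ n)] := commXg_lcn Lp2 _ Lh Gg => //.
  move/(canLR (mulgK _)) => <-; rewrite groupM ?groupV //.
    apply: subsetP (powers_comm _) _ _ => //; rewrite mem_commg //.
    by rewrite (subsetP IH) // mem_powers.
  have big k : p <= k -> p.+1 < (j.+2 * k).+1.
    move=> lepk; rewrite ltnS (leq_trans _ (leq_mul (isT : 1 < j.+2) lepk)) // mul2n -addnn.
    by rewrite -addn1 leq_add2l prime_gt0.
  apply: (@hall_tail (<<[set u ^+ n | u in 'L_j.+4(G)]>>)%G c) => [k /andP[k_gt1 _]||] /=.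
  - apply: (mem_powers_leq _ (Lc k k_gt1)); rewrite ltnS.
    by rewrite (leq_trans _ (leq_mul (leqnn j.+2) k_gt1)) // muln2 -addnn addSnnS leq_addl.
  - by rewrite (lcn_mem_triv _ (Lc p (prime_gt1 p_pr))) ?big // expg1n.
  by rewrite (lcn_mem_triv _ (Lc p.+1 _)) ?big // ltnS prime_gt0.
have sV j : V 2 \subset V j.+2.
  by elim: j => // j IH; apply: subset_trans IH (step j).
move=> Lu; apply/set1gP; have /subsetP sVp := sV p.
have -> : [1 gT] = V p.+2.
  rewrite /V Lp2 imset_set1 expg1n; apply/esym/eqP; rewrite -subG1 gen_subG; exact: subxx.
exact: sVp (mem_powers Lu).
Qed.

Lemma commute_pow : [~ z ^+ n, y] = 1.
Proof.
have [|c Lc ->] := @commXg_lcn _ _ _ Lp2 1 z y _ Gz Gy => //.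
rewrite lcn2_exponent ?mul1g; last by rewrite lcn2 mem_commg.
apply/set1gP; apply: (@hall_tail 1%G c) => [k /andP[k_gt1 _]||] /=; apply/set1gP.
- apply: lcn2_exponent; apply: subsetP (lcn_sub_leq _ _) _ (Lc k k_gt1).
  by rewrite mul1n ltnS ltnW.
- by rewrite pow_lcn_last // -[p in 'L_p.+1(_)]mul1n Lc ?prime_gt1.
by rewrite (lcn_mem_triv _ (Lc p.+1 _)) ?mul1n // ltnS prime_gt0.
Qed.

End CommutingPowers.

(** * Iterated commutators and the Dynkin identity *)

(* The Lie bracket [..[X_i1, X_i2],.., X_in] expanded as a signed list of words. *)
Definition bracket_step (L : seq (int * seq nat)) (l : nat) :=
  [seq (e.1, rcons e.2 l) | e <- L] ++ [seq (- e.1, l :: e.2)%R | e <- L].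

Definition bracket_words (v : seq nat) : seq (int * seq nat) :=
  if v is i :: w then foldl bracket_step [:: (1%R, [:: i])] w else [::].

(** The linear form with value [F w] on each word w, evaluated at the Lie polynomial of [v]. *)
Definition bracket_sum (A : zmodType) (F : seq nat -> A) (v : seq nat) : A :=
  (\sum_(e <- bracket_words v) F e.2 *~ e.1)%R.

Definition left_comm (gT : finGroupType) (x : nat -> gT) (g : gT) (u : seq nat) :=
  foldl (fun h i => [~ h, x i]) g u.

Definition word_comm (gT : finGroupType) (x : nat -> gT) (v : seq nat) :=
  if v is i :: u then left_comm x (x i) u else 1.

Section BracketWords.

Variable A : zmodType.
Implicit Types (F : seq nat -> A) (v w : seq nat).

Lemma bracket_words_rcons v l : v != [::] ->
  bracket_words (rcons v l) = bracket_step (bracket_words v) l.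
Proof. by case: v => // i w _; rewrite /= foldl_rcons. Qed.

Lemma bracket_sum1 F i : bracket_sum F [:: i] = F [:: i].
Proof. by rewrite /bracket_sum /= big_seq1 mulr1z. Qed.

Lemma bracket_sum_rcons F v l : v != [::] ->
  bracket_sum F (rcons v l)
    = (bracket_sum (fun w => F (rcons w l)) v - bracket_sum (fun w => F (l :: w)) v)%R.
Proof.
move=> v_n0; rewrite /bracket_sum bracket_words_rcons // big_cat !big_map /=.
by congr (_ + _)%R; rewrite -sumrN; apply: eq_bigr => e _; rewrite mulrNz.
Qed.

Lemma perm_bracket_words v e : e \in bracket_words v -> perm_eq e.2 v.
Proof.
elim/last_ind: v e => // v l IH e.
case: (eqVneq v [::]) => [-> | v_n0]; first by rewrite inE => /eqP->.
rewrite bracket_words_rcons // mem_cat => /orP[] /mapP[f /IH eq_f ->] /=.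
  by rewrite -!cats1 perm_cat2r.
by rewrite perm_sym perm_rcons perm_cons perm_sym.
Qed.

Lemma eq_bracket_sum F1 F2 v :
  (forall w, perm_eq w v -> F1 w = F2 w) -> bracket_sum F1 v = bracket_sum F2 v.
Proof. by move=> eqF; apply: eq_big_seq => e /perm_bracket_words/eqF->. Qed.

Lemma bracket_sumMn F v k :
  bracket_sum (fun w => F w *+ k)%R v = (bracket_sum F v *+ k)%R.
Proof. by rewrite /bracket_sum -sumrMnl; apply: eq_bigr => e _; rewrite !(pmulrn _ k) mulrzAC. Qed.

End BracketWords.

Section GradedCommutators.

Variables (gT : finGroupType) (G : {group gT}) (x : nat -> gT).
Hypothesis Gx : forall i, x i \in G.

Notation comml := (left_comm x).
Notation cw := (word_comm x).

Lemma left_comm_mem k g u : 0 < k -> g \in 'L_k(G) -> comml g u \in 'L_(k + size u)(G).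
Proof.
elim: u k g => [|i u IH] k g k_gt0 Lg; first by rewrite addn0.
by rewrite /= -addSnnS; apply: IH => //; rewrite (subsetP (lcnSnS _ _)) ?mem_commg.
Qed.

Lemma word_comm_mem v : v != [::] -> cw v \in 'L_(size v)(G).
Proof. by case: v => // i u _; rewrite [size _]/= -(add1n (size u)) left_comm_mem ?lcn1. Qed.

Lemma left_comm1 u : comml 1 u = 1.
Proof. by elim: u => //= i u IH; rewrite comm1g. Qed.

Lemma left_comm_cons g i u : comml g (i :: u) = comml [~ g, x i] u.
Proof. by []. Qed.

Lemma left_comm_rcons g u l : comml g (rcons u l) = [~ comml g u, x l].
Proof. by rewrite /left_comm foldl_rcons. Qed.

Lemma left_comm_cat g u w : comml g (u ++ w) = comml (comml g u) w.
Proof. by rewrite /left_comm foldl_cat. Qed.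

Lemma word_comm_cat v u : v != [::] -> cw (v ++ u) = comml (cw v) u.
Proof. by case: v => // i v _; rewrite /= left_comm_cat. Qed.

Lemma word_comm_rcons v l : v != [::] -> cw (rcons v l) = [~ cw v, x l].
Proof. by case: v => // i v _; rewrite /= left_comm_rcons. Qed.

Variables (n : nat) (A : zmodType) (cl : gT -> A).
Hypothesis clM : forall g h, g \in 'L_n(G) -> h \in 'L_n(G) -> cl (g * h) = (cl g + cl h)%R.
Hypothesis cl0 : forall g, g \in 'L_n.+1(G) -> cl g = 0%R.

Lemma cl_left_comm0 k l u : 0 < k -> l \in 'L_k(G) -> n < k + size u -> cl (comml l u) = 0%R.
Proof.
move=> k_gt0 Ll ltn; apply: cl0.
exact: (subsetP (lcn_sub_leq G ltn)) (left_comm_mem u k_gt0 Ll).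
Qed.

Lemma comm_lcn_mem i j g h : 0 < i -> 0 < j -> g \in 'L_i(G) -> h \in 'L_j(G) ->
  [~ g, h] \in 'L_(i + j)(G).
Proof. by move=> i0 j0 Lg Lh; rewrite (subsetP (lcn_comm G i0 j0)) ?mem_commg. Qed.

(** Commutators of total weight n are multilinear modulo weight n + 1: the correction
    [[~ g, x i, h]] becomes too deep once bracketed with the rest of [u]. *)
Lemma cl_left_commM k g h u : 0 < k -> k + size u = n ->
    g \in 'L_k(G) -> h \in 'L_k(G) ->
  cl (comml (g * h) u) = (cl (comml g u) + cl (comml h u))%R.
Proof.
elim: u k g h => [|i u IH] k g h k_gt0 def_n Lg Lh.
  by rewrite addn0 in def_n; rewrite /= clM -?def_n.
have Lxi : x i \in 'L_1(G) by rewrite lcn1.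
have def_n' : k.+1 + size u = n by rewrite addSnnS.
have Lgi : [~ g, x i] \in 'L_k.+1(G) by rewrite -addn1 comm_lcn_mem.
have Lhi : [~ h, x i] \in 'L_k.+1(G) by rewrite -addn1 comm_lcn_mem.
have Lgh : [~ g, x i, h] \in 'L_(k.+1 + k)(G) by rewrite comm_lcn_mem.
have Lgh1 : [~ g, x i, h] \in 'L_k.+1(G).
  by rewrite (subsetP (lcn_sub_leq G _) _ Lgh) ?leq_addr.
have Lgg : [~ g, x i] * [~ g, x i, h] \in 'L_k.+1(G) by rewrite groupM.
rewrite !left_comm_cons commMgR (IH _ _ _ (ltn0Sn k) def_n' Lgg Lhi) (IH _ _ _ (ltn0Sn k) def_n' Lgi Lgh1).
rewrite [X in (_ + X + _)%R](cl_left_comm0 _ Lgh) ?addr0 //.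
by rewrite -def_n' addnAC -[X in X < _]addn0 ltn_add2l.
Qed.

Lemma cl_left_commV k g u : 0 < k -> k + size u = n -> g \in 'L_k(G) ->
  cl (comml g^-1 u) = (- cl (comml g u))%R.
Proof.
move=> k_gt0 def_n Lg; apply/eqP; rewrite -GRing.addr_eq0.
by rewrite -(cl_left_commM k_gt0) ?groupV // mulVg left_comm1 cl0.
Qed.

Lemma cl_left_commJ k g h u : 0 < k -> k + size u = n -> g \in 'L_k(G) -> h \in G ->
  cl (comml (g ^ h) u) = cl (comml g u).
Proof.
move=> k_gt0 def_n Lg Gh; rewrite conjg_mulR.
have Lgh : [~ g, h] \in 'L_k.+1(G) by rewrite (subsetP (lcnSnS _ _)) ?mem_commg.
rewrite (cl_left_commM k_gt0) ?(subsetP (lcn_subS _ _) _ Lgh) //.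
by rewrite (cl_left_comm0 _ Lgh) ?addr0 // addSn def_n.
Qed.

Lemma cl_commMl i j g g' h u : 0 < i -> 0 < j -> i + j + size u = n ->
    g \in 'L_i(G) -> g' \in 'L_i(G) -> h \in 'L_j(G) ->
  cl (comml [~ g * g', h] u) = (cl (comml [~ g, h] u) + cl (comml [~ g', h] u))%R.
Proof.
move=> i0 j0 def_n Lg Lg' Lh; have ij0 : 0 < i + j by rewrite addn_gt0 i0.
rewrite commMgJ (cl_left_commM ij0) ?comm_lcn_mem //; last first.
  by rewrite memJ_norm ?comm_lcn_mem // (subsetP (lcn_norm _ _)) // (subsetP (lcn_sub i G)).
by rewrite (cl_left_commJ ij0) ?comm_lcn_mem // (subsetP (lcn_sub i G)).
Qed.

Lemma cl_commMr i j g h h' u : 0 < i -> 0 < j -> i + j + size u = n ->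
    g \in 'L_i(G) -> h \in 'L_j(G) -> h' \in 'L_j(G) ->
  cl (comml [~ g, h * h'] u) = (cl (comml [~ g, h] u) + cl (comml [~ g, h'] u))%R.
Proof.
move=> i0 j0 def_n Lg Lh Lh'; have ij0 : 0 < i + j by rewrite addn_gt0 i0.
rewrite commgMJ (cl_left_commM ij0) ?comm_lcn_mem //; last first.
  by rewrite memJ_norm ?comm_lcn_mem // (subsetP (lcn_norm _ _)) // (subsetP (lcn_sub j G)).
by rewrite addrC (cl_left_commJ ij0) ?comm_lcn_mem // (subsetP (lcn_sub j G)).
Qed.

Lemma cl_commC i j g h u : 0 < i -> 0 < j -> i + j + size u = n ->
    g \in 'L_i(G) -> h \in 'L_j(G) ->
  cl (comml [~ g, h] u) = (- cl (comml [~ h, g] u))%R.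
Proof.
move=> i0 j0 def_n Lg Lh; rewrite -invg_comm (@cl_left_commV (i + j)) ?addn_gt0 ?i0 //.
by rewrite addnC comm_lcn_mem.
Qed.

Lemma cl_commJl i j g h w u : 0 < i -> 0 < j -> i + j + size u = n ->
    g \in 'L_i(G) -> h \in 'L_j(G) -> w \in G ->
  cl (comml [~ g ^ w, h] u) = cl (comml [~ g, h] u).
Proof.
move=> i0 j0 def_n Lg Lh Gw; have Lgw : [~ g, w] \in 'L_i.+1(G).
  by rewrite (subsetP (lcnSnS _ _)) ?mem_commg.
rewrite conjg_mulR (cl_commMl i0 j0) ?(subsetP (lcn_subS _ _) _ Lgw) //.
rewrite [X in (_ + X)%R](@cl_left_comm0 (i.+1 + j)) ?addr0 ?comm_lcn_mem //.
by rewrite !addSn def_n.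
Qed.

Lemma cl_commVr i j g h u : 0 < i -> 0 < j -> i + j + size u = n ->
    g \in 'L_i(G) -> h \in 'L_j(G) ->
  cl (comml [~ g, h^-1] u) = (- cl (comml [~ g, h] u))%R.
Proof.
move=> i0 j0 def_n Lg Lh; apply/eqP; rewrite -GRing.addr_eq0.
by rewrite -(cl_commMr i0 j0) ?groupV // mulVg commg1 left_comm1 cl0.
Qed.

(** The Hall-Witt identity for a, b^-1, z: modulo weight n + 1 its conjugations disappear and its
    three factors add up to 0. *)
Lemma cl_Jacobi i k a b z u : 0 < i -> 0 < k -> (i + k).+1 + size u = n ->
    a \in 'L_i(G) -> b \in 'L_k(G) -> z \in G ->
  cl (comml [~ a, [~ b, z]] u)
    = (cl (comml [~ a, b, z] u) - cl (comml [~ a, z, b] u))%R.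
Proof.
move=> i0 k0 def_n La Lb Gz; have Lz : z \in 'L_1(G) by rewrite lcn1.
have Ga : a \in G by rewrite (subsetP (lcn_sub i G)).
have Gb : b \in G by rewrite (subsetP (lcn_sub k G)).
have Lab : [~ a, b] \in 'L_(i + k)(G) by apply: comm_lcn_mem.
have Lbz : [~ b, z] \in 'L_k.+1(G) by rewrite -addn1 comm_lcn_mem.
have Laz : [~ a, z] \in 'L_i.+1(G) by rewrite -addn1 comm_lcn_mem.
have Labz : [~ a, b, z] \in 'L_(i + k).+1(G) by rewrite -addn1 comm_lcn_mem ?addn_gt0 ?i0.
have Lbza : [~ b, z, a] \in 'L_(i + k).+1(G) by rewrite addnC -addSn comm_lcn_mem.
have Lazb : [~ a, z, b] \in 'L_(i + k).+1(G) by rewrite -addSn comm_lcn_mem.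
have nL g h j : g \in 'L_j(G) -> h \in G -> g ^ h \in 'L_j(G).
  by move=> Lg Gh; rewrite memJ_norm // (subsetP (lcn_norm j G)).
have eq_bz : [~ b^-1, z^-1] = [~ b, z] ^ (z^-1 * b^-1).
  by rewrite !commgEl !conjgE !gnorm.
have eq_za : [~ z, a^-1] = [~ a, z] ^ a^-1 by rewrite !commgEl !conjgE !gnorm.
have := congr1 (fun g => cl (comml g u)) (Hall_Witt_identity a b^-1 z).
rewrite /= invgK left_comm1 eq_bz eq_za.
have LJ1 : [~ [~ b, z] ^ (z^-1 * b^-1), a] \in 'L_(i + k).+1(G).
  rewrite addnC -addSn comm_lcn_mem //; apply: nL => //.
  by rewrite groupM ?groupV.
have LJ2 : [~ [~ a, z] ^ a^-1, b^-1] \in 'L_(i + k).+1(G).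
  by rewrite -addSn comm_lcn_mem ?groupV //; apply: nL; rewrite ?groupV.
have Lg1 := nL _ b^-1 _ Labz (groupVr Gb); have Lg2 := nL _ z _ LJ1 Gz.
have Lg3 := nL _ a _ LJ2 Ga; have cM := cl_left_commM (ltn0Sn (i + k)) def_n.
have cJ := cl_left_commJ (ltn0Sn (i + k)) def_n.
rewrite (cM _ _ (groupM Lg1 Lg2) Lg3) (cM _ _ Lg1 Lg2) !cJ ?groupV //.
have def_n1 : k.+1 + i + size u = n by rewrite addSn (addnC k).
have def_n2 : i.+1 + k + size u = n by rewrite addSn.
have LJ3 := nL _ a^-1 _ Laz (groupVr Ga).
rewrite (cl_commJl (ltn0Sn k) i0 def_n1 Lbz La) ?groupM ?groupV //.
rewrite (cl_commVr (ltn0Sn i) k0 def_n2) // (cl_commJl (ltn0Sn i) k0 def_n2) ?groupV //.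
rewrite (cl_commC (ltn0Sn k) i0 def_n1 Lbz La) //.
rewrite (cl0 (group1 _)) => /eqP; rewrite addrAC GRing.subr_eq0 => /eqP.
by move=> <-.
Qed.

(** By Jacobi, bracketing on the right with a Lie element acts as its associative expansion, applied
    letter by letter. *)
Lemma cl_comm_word i a v u : 0 < i -> v != [::] -> i + size v + size u = n -> a \in 'L_i(G) ->
  cl (comml [~ a, cw v] u) = bracket_sum (fun w => cl (comml a (w ++ u))) v.
Proof.
elim/last_ind: v i a u => // v l IH i a u i0 _ def_n La.
case: (eqVneq v [::]) => [-> | v_n0]; first by rewrite bracket_sum1.
have Lv := word_comm_mem v_n0; have v0 : 0 < size v by rewrite lt0n size_eq0.
have Lal : [~ a, x l] \in 'L_i.+1(G) by rewrite -addn1 comm_lcn_mem ?lcn1.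
rewrite size_rcons addnS in def_n.
rewrite word_comm_rcons // (cl_Jacobi i0 v0) // bracket_sum_rcons //.
rewrite -[comml [~ a, cw v, x l] u]/(comml [~ a, cw v] (l :: u)).
rewrite (IH i) ?addnS // (IH i.+1) ?addSn //.
by congr (_ - _)%R; apply: eq_bracket_sum => w _; rewrite ?cat_rcons.
Qed.

(* Counting a single letter [m] instead of all letters keeps the weights of the
   Dynkin identity invertible modulo p up to degree p. *)
Lemma dynkin_count m v u : v != [::] -> size v + size u = n ->
  bracket_sum (fun w => if ohead w == Some m then cl (cw (w ++ u)) else 0%R) v
    = (cl (cw (v ++ u)) *+ count_mem m v)%R.
Proof.
elim/last_ind: v u => // v l IH u _ def_n.
case: (eqVneq v [::]) => [-> | v_n0].
  rewrite bracket_sum1 /= addn0; rewrite -[Some l == _]/(l == m).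
  by case: eqP => _; rewrite ?mulr1n ?mulr0n.
have Lv := word_comm_mem v_n0; have v0 : 0 < size v by rewrite lt0n size_eq0.
rewrite size_rcons in def_n.
rewrite bracket_sum_rcons //.
have -> : bracket_sum (fun w => if ohead (rcons w l) == Some m
    then cl (cw (rcons w l ++ u)) else 0%R) v = (cl (cw (v ++ l :: u)) *+ count_mem m v)%R.
  rewrite -IH // ?addnS //; apply: eq_bracket_sum => w eq_wv.
  rewrite cat_rcons; case: w eq_wv => // /perm_size/esym/eqP.
  by rewrite size_eq0 (negPf v_n0).
rewrite -cats1 count_cat -catA cat1s /= addn0 mulrnDr; congr (_ + _)%R.
rewrite -[Some l == _]/(l == m); case: eqP => [-> | _]; last first.
  by rewrite mulr0n /bracket_sum big1 ?GRing.oppr0 // => e _; rewrite mul0rz.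
(* The words [l :: w] sum to -[x_l, [v]], which is [[v], x_l]: this is the contribution of the new
   occurrence of [m]. *)
rewrite mulr1n -(cl_comm_word (i := 1)) ?lcn1 // ?add1n //.
rewrite (cl_commC (i := 1) (j := size v)) ?lcn1 ?GRing.opprK //.
by rewrite word_comm_cat.
Qed.

Lemma cl_left_commX k g u e : 0 < k -> k + size u = n -> g \in 'L_k(G) ->
  cl (comml (g ^+ e) u) = (cl (comml g u) *+ e)%R.
Proof.
move=> k0 def_n Lg; elim: e => [|e IH]; first by rewrite left_comm1 cl0 ?group1.
by rewrite expgS (cl_left_commM k0) ?groupX // IH mulrS.
Qed.

Lemma cl_commXr i j g h u e : 0 < i -> 0 < j -> i + j + size u = n ->
    g \in 'L_i(G) -> h \in 'L_j(G) ->
  cl (comml [~ g, h ^+ e] u) = (cl (comml [~ g, h] u) *+ e)%R.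
Proof.
move=> i0 j0 def_n Lg Lh; elim: e => [|e IH]; first by rewrite commg1 left_comm1 cl0 ?group1.
by rewrite expgS (cl_commMr i0 j0) ?groupX // IH mulrS.
Qed.

Lemma cl_word_exponent v i e : size v = n -> i \in v -> x i ^+ e = 1 ->
  (cl (cw v) *+ e = 0)%R.
Proof.
move=> def_n /splitPr v_i xe; case: v / v_i def_n => v w def_n.
case: (eqVneq v [::]) => [v0 | v_n0].
  rewrite {}v0 /= in def_n *.
  by rewrite -(cl_left_commX (k := 1)) ?lcn1 // xe left_comm1 cl0 ?group1.
have Lv := word_comm_mem v_n0; have v0 : 0 < size v by rewrite lt0n size_eq0.
rewrite word_comm_cat // left_comm_cons -(cl_commXr (i := size v) (j := 1)) ?lcn1 //.
  by rewrite xe commg1 left_comm1 cl0 ?group1.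
by rewrite -def_n size_cat addnAC addn1 addnS.
Qed.

Lemma word_comm_const m v : 1 < size v -> all (pred1 m) v -> cw v = 1.
Proof.
case: v => [|i [|j v]] //= _ /and3P[/eqP-> /eqP-> _].
by rewrite commgg; apply: left_comm1.
Qed.

Lemma gen_ind (S : {set gT}) (Q : gT -> Prop) :
    Q 1 -> (forall g h, g \in <<S>> -> h \in <<S>> -> Q g -> Q h -> Q (g * h)) ->
    (forall g, g \in S -> Q g) ->
  forall g, g \in <<S>> -> Q g.
Proof.
move=> Q1 QM QS g /gen_prodgP[m [c Sc ->]].
suff [] : \prod_(i < m) c i \in <<S>> /\ Q (\prod_(i < m) c i) by [].
elim/big_ind: _ => [|u v [Su Qu] [Sv Qv] | i _]; first by rewrite group1.
  by rewrite groupM //; split=> //; apply: QM.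
by rewrite mem_gen ?Sc //; split=> //; apply: QS.
Qed.

Variable S : {set gT}.
Hypotheses (genG : G :=: <<S>>) (defS : forall s, s \in S -> exists i, s = x i).

Lemma left_comm_span k g u : 0 < k -> k + size u = n -> g \in 'L_k(G) ->
  exists2 L : seq (seq nat), all (fun v => size v == k) L
    & cl (comml g u) = (\sum_(v <- L) cl (cw (v ++ u)))%R.
Proof.
case: k => // k _; elim: k g u => [|k IH] g u def_n.
  rewrite lcn1 [in X in X -> _]genG; elim/gen_ind: g / => [|g h|g /defS[i ->]].
  - by exists [::] => //; rewrite big_nil left_comm1 cl0.
  - rewrite -genG => Gg Gh [L1 sL1 def_g] [L2 sL2 def_h].
    exists (L1 ++ L2); first by rewrite all_cat sL1.
    by rewrite (cl_left_commM (k := 1)) ?lcn1 // big_cat def_g def_h.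
  by exists [:: [:: i]] => //; rewrite big_seq1.
rewrite lcnSn; elim/gen_ind: g / => [|g h|_ /imset2P[h y Lh Gy ->]].
- by exists [::] => //; rewrite big_nil left_comm1 cl0.
- move=> Lg Lg' [L1 sL1 def_g] [L2 sL2 def_h].
  exists (L1 ++ L2); first by rewrite all_cat sL1.
  by rewrite (cl_left_commM (ltn0Sn k.+1) def_n Lg Lg') big_cat def_g def_h.
move: Gy; rewrite [in X in X -> _]genG; elim/gen_ind: y / => [|y z|y /defS[i ->]].
- by exists [::] => //; rewrite big_nil commg1 left_comm1 cl0.
- rewrite -genG => Gy Gz [L1 sL1 def_g] [L2 sL2 def_h].
  exists (L1 ++ L2); first by rewrite all_cat sL1.
  by rewrite (cl_commMr (i := k.+1) (j := 1)) ?lcn1 ?addn1 // big_cat def_g def_h.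
have [||L sL def_h] := IH h (i :: u); rewrite ?addnS //.
exists [seq rcons v i | v <- L].
  by rewrite all_map; apply: sub_all sL => v /eqP <-; rewrite /= size_rcons.
by rewrite -left_comm_cons def_h big_map; apply: eq_bigr => v _; rewrite cat_rcons.
Qed.

Lemma word_comm_span g : 0 < n -> g \in 'L_n(G) ->
  exists2 L : seq (seq nat), all (fun v => size v == n) L
    & cl g = (\sum_(v <- L) cl (cw v))%R.
Proof.
move=> n_gt0 Lg; have [|L sL def_g] := left_comm_span n_gt0 (u := [::]) _ Lg.
  exact: addn0.
by exists L => //; rewrite -[g]/(comml g [::]) def_g; apply: eq_bigr => v _; rewrite cats0.
Qed.

Variables (p N : nat).
Hypotheses (p_pr : prime p) (n_gt1 : 1 < n) (le_np : n <= p).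
Hypothesis cl_exp : forall v, size v = n -> (cl (cw v) *+ (p ^ N) = 0)%R.

(** The least letter is the same for all words in one bracket. [omega] inverts its multiplicity
    modulo p^N by Euler's theorem, so that [phi] is a linear form on words which recovers the class
    of a commutator from its Lie polynomial. *)
Let pivot v := head 0 (sort leq v).

Let omega v := ((count_mem (pivot v) v) ^ (totient (p ^ N)).-1)%N.

Let phi v := if ohead v == Some (pivot v) then (cl (cw v) *+ omega v)%R else 0%R.

Lemma mulrn_mod a m e : (a *+ e = 0 :> A -> a *+ m = a *+ (m %% e))%R.
Proof. by move=> ae0; rewrite {1}(divn_eq m e) mulrnDr mulnC mulrnA ae0 mul0rn add0r. Qed.

Lemma bracket_sum_phi v : size v = n -> bracket_sum phi v = cl (cw v).
Proof.
move=> sv; have v_n0 : v != [::] by rewrite -size_eq0 sv -lt0n ltnW.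
rewrite (@eq_bracket_sum _ phi (fun w => (if ohead w == Some (pivot v)
    then cl (cw (w ++ [::])) else 0) *+ omega v)%R); last first.
  move=> w eq_wv; have eq_piv : pivot w = pivot v.
    by congr head; apply/perm_sortP => //; [exact: leq_total | exact: leq_trans | exact: anti_leq].
  have -> : omega v = omega w by rewrite /omega eq_piv (seq.permP eq_wv).
  by rewrite /phi eq_piv cats0; case: ifP => // _; rewrite mul0rn.
rewrite bracket_sumMn dynkin_count ?addn0 // cats0 -mulrnA.
(* A constant word has multiplicity n, possibly equal to p, but its commutator is trivial. Otherwise
   the multiplicity lies strictly between 0 and p. *)
have [/word_comm_const cv1 | nconst] := boolP (all (pred1 (pivot v)) v).
  by rewrite cv1 ?sv // cl0 ?group1 // mul0rn.
have piv_v : pivot v \in v.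
  by rewrite /pivot -(mem_sort leq); case: (sort leq v) (size_sort leq v) => [|i w _];
    [rewrite sv; case: (n) n_gt1 | rewrite mem_head].
have co_p : coprime (count_mem (pivot v) v) (p ^ N).
  rewrite coprime_sym coprimeXl // prime_coprime // gtnNdvd //.
    by rewrite -has_count has_pred1.
  apply: leq_trans le_np; rewrite -sv ltn_neqAle count_size andbT.
  by rewrite -all_count.
rewrite (mulrn_mod _ (cl_exp sv)) -expnS prednK ?totient_gt0 ?expn_gt0 ?prime_gt0 //.
by rewrite Euler_exp_totient // -(mulrn_mod _ (cl_exp sv)).
Qed.

Definition word_coef (L : seq (seq nat)) w : int :=
  (\sum_(v <- L) bracket_sum (fun w' => (w' == w)%:R) v)%R.

(** The sum of classes equals the sum over words w of [phi w] times the coefficient of w, and each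
    [phi w] is 0 or a multiple of the class of the commutator of w. *)
Lemma dynkin_criterion L : all (fun v => size v == n) L ->
    (forall w, size w = n -> cl (cw w) *~ word_coef L w = 0)%R ->
  (\sum_(v <- L) cl (cw v) = 0)%R.
Proof.
move=> sL coef0.
have -> : (\sum_(v <- L) cl (cw v) = \sum_(v <- L) bracket_sum phi v)%R.
  by apply: eq_big_seq => v /(allP sL)/eqP/bracket_sum_phi.
pose W := undup (flatten [seq [seq e.2 | e <- bracket_words v] | v <- L]).
have memW v e : v \in L -> e \in bracket_words v -> e.2 \in W.
  by move=> Lv Be; rewrite mem_undup; apply/flatten_mapP; exists v => //; apply: map_f.
have phiE w : w \in W -> phi w = (\sum_(w' <- W) phi w' *~ (w == w')%:R)%R.
  move=> Ww; rewrite (bigD1_seq w) ?undup_uniq //= eqxx mulr1z big1 ?addr0 // => w' neq_w'.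
  by rewrite eq_sym (negPf neq_w') mulr0z.
transitivity (\sum_(w <- W) phi w *~ word_coef L w)%R; last first.
  rewrite big_seq big1 // => w; rewrite mem_undup => /flatten_mapP[v Lv /mapP[e Be ->]].
  have se : size e.2 = n.
    by rewrite (perm_size (perm_bracket_words Be)); apply/eqP/(allP sL).
  rewrite /phi; case: ifP => _; last by rewrite mul0rz.
  by rewrite pmulrn mulrzAC coef0 // mul0rz.
under [RHS]eq_bigr => w _ do rewrite /word_coef mulrz_sumr.
rewrite exchange_big; apply: eq_big_seq => v Lv.
under [RHS]eq_bigr => w _ do rewrite mulrz_sumr.
rewrite exchange_big; apply: eq_big_seq => e Be /=.
rewrite {1}(phiE _ (memW v e Lv Be)) mulrz_suml; apply: eq_bigr => w _.
by rewrite -mulrzA mulrzz.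
Qed.

End GradedCommutators.

(** An alias carrying the proof of commutativity, so that an additive structure can be attached to
    the type. *)
Definition abelian_zmod (gT : finGroupType) (A : {group gT}) (cA : abelian A) : Type :=
  subg_of A.

Section AbelianZmod.

Variables (gT : finGroupType) (A : {group gT}) (cA : abelian A).

HB.instance Definition _ := Finite.copy (abelian_zmod cA) (subg_of A).

Lemma abelian_zmod_addC : commutative (fun u v : subg_of A => u * v).
Proof.
by move=> u v; apply: val_inj; rewrite /= (centsP cA) ?subgP.
Qed.

HB.instance Definition _ := GRing.isZmodule.Build (abelian_zmod cA)
  (@mulgA (subg_of A)) abelian_zmod_addC (@mul1g (subg_of A)) (@mulVg (subg_of A)).

End AbelianZmod.

Lemma lcn_factor_zmod (gT : finGroupType) (G : {group gT}) n :
  exists (A : zmodType) (cl : gT -> A),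
  [/\ forall g h, g \in 'L_n(G) -> h \in 'L_n(G) -> cl (g * h) = (cl g + cl h)%R,
      forall g, g \in 'L_n.+1(G) -> cl g = 0%R
    & forall g, g \in 'L_n(G) -> cl g = 0%R -> g \in 'L_n.+1(G)].
Proof.
have cQ : abelian ('L_n(G) / 'L_n.+1(G)).
  have sZ := lcn_central n G.
  by apply: abelianS sZ (center_abelian _).
have nL g : g \in 'L_n(G) -> g \in 'N('L_n.+1(G)).
  by move=> Lg; rewrite (subsetP (lcn_norm _ _)) // (subsetP (lcn_sub n G)).
exists (abelian_zmod cQ : zmodType), (fun g => subg ('L_n(G) / 'L_n.+1(G)) (coset 'L_n.+1(G) g)).
have Qg g : g \in 'L_n(G) -> coset 'L_n.+1(G) g \in 'L_n(G) / 'L_n.+1(G).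
  by move=> Lg; rewrite mem_quotient.
split=> [g h Lg Lh | g Lg | g Lg].
- by rewrite morphM ?nL // [LHS]morphM ?Qg.
- by rewrite coset_id // [LHS]morph1.
move/(congr1 sgval); rewrite subgK ?Qg // => /= cg1.
exact: coset_idr (nL g Lg) cg1.
Qed.

(** * Unitriangular representations *)

Section Band.

Local Open Scope ring_scope.

Variables (R : nzRingType) (d : nat).
Implicit Types A B : 'M[R]_d.+1.

Definition band k B := forall s t : 'I_d.+1, (t < s + k)%N -> B s t = 0.

Lemma band_mul j k A B : band j A -> band k B -> band (j + k) (A * B).
Proof.
move=> bA bB s t lt_ts; rewrite mxE big1 // => l _.
have [lt_ls | le_sl] := ltnP l (s + j); first by rewrite bA ?mul0r.
rewrite (bB l t) ?mulr0 //; apply: leq_trans lt_ts _.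
by rewrite addnA leq_add2r.
Qed.

Lemma band_add k A B : band k A -> band k B -> band k (A + B).
Proof. by move=> bA bB s t lt_ts; rewrite mxE bA ?bB ?addr0. Qed.

Lemma band_opp k A : band k A -> band k (- A).
Proof. by move=> bA s t lt_ts; rewrite mxE bA ?oppr0. Qed.

Lemma band_sub k A B : band k A -> band k B -> band k (A - B).
Proof. by move=> bA bB; apply/band_add/band_opp. Qed.

Lemma band_leq j k A : (j <= k)%N -> band k A -> band j A.
Proof. by move=> lejk bA s t lt_ts; apply: bA; apply: leq_trans lt_ts _; rewrite leq_add2l. Qed.

Lemma band_one : band 0 (1 : 'M[R]_d.+1).
Proof. by move=> s t; rewrite addn0 mxE => /gtn_eqF; rewrite -val_eqE /= => ->. Qed.

Lemma band_mul1r k A B : band k A -> band 1 (B - 1) -> band k.+1 (B * A - A).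
Proof.
by move=> bA bB; rewrite -{2}[A]mul1r -mulrBl -add1n; apply: band_mul.
Qed.

Lemma band_unip A : band 1 (A - 1) -> band 0 A.
Proof.
move=> bA; rewrite -[A](subrK 1); apply: band_add band_one; exact: band_leq bA.
Qed.

Lemma band_unip_mul k A B : band k.+1 (A - 1) -> band k.+1 (B - 1) -> band k.+1 (A * B - 1).
Proof.
move=> bA bB; have -> : A * B - 1 = (A - 1) * B + (B - 1).
  by rewrite mulrBl mul1r addrA subrK.
apply: band_add => //; rewrite -[k.+1]addn0; apply: band_mul => //.
by apply: band_unip; apply: band_leq bB.
Qed.

Definition entry A s t := A (inord s) (inord t).

Lemma band_entry k A B s t : band k.+1 (A - B) ->
  (s <= d)%N -> (t <= d)%N -> (t <= s + k)%N -> entry A s t = entry B s t.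
Proof.
move=> bAB les let_ lets; apply/eqP; rewrite -subr_eq0; apply/eqP.
by have := bAB (inord s) (inord t); rewrite !mxE !inordK // addnS ltnS => ->.
Qed.

Lemma entry_add A B s t : entry (A + B) s t = entry A s t + entry B s t.
Proof. by rewrite /entry mxE. Qed.

Lemma entry_sub A B s t : entry (A - B) s t = entry A s t - entry B s t.
Proof. by rewrite /entry !mxE. Qed.

Lemma entry_one s t : (s <= d)%N -> (t <= d)%N -> entry 1 s t = (s == t)%:R.
Proof. by move=> les let_; rewrite /entry mxE -val_eqE /= !inordK. Qed.

Variable u : seq nat.
Hypothesis size_u : size u = d.

(* The Magnus substitution [x_i |-> 1 + X_i] read along the word [u]: entry (s, t)
   of a product is the coefficient of the subword of [u] from s to t. *)
Definition step_mx i : 'M[R]_d.+1 :=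
  \matrix_(s, t) ((s == t)%:R + ((t == s.+1 :> nat) && (nth 0%N u s == i))%:R).

Lemma step_mx_band i : band 1 (step_mx i - 1).
Proof.
move=> s t; rewrite addn1 ltnS !mxE [_%:R + _]addrC addrK => lets.
by rewrite ltn_eqF //= ltnS.
Qed.

Lemma entry_step_mull i A s t : (s <= d)%N ->
  entry (step_mx i * A) s t
    = entry A s t + (if (s < d)%N && (nth 0%N u s == i) then entry A s.+1 t else 0).
Proof.
move=> les; rewrite /entry mxE.
under eq_bigr => j _ do rewrite mxE mulrDl inordK //.
rewrite big_split /= (bigD1 (inord s)) //= eqxx mul1r big1 ?addr0; last first.
  by move=> j neq_j; rewrite eq_sym (negPf neq_j) mul0r.
congr (_ + _); case: ltnP => [lts | led] /=; last first.
  rewrite big1 // => j _; rewrite ltn_eqF ?mul0r //.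
  by rewrite (leq_trans (ltn_ord j)).
rewrite (bigD1 (inord s.+1)) //= inordK // eqxx /= big1 ?addr0; last first.
  move=> j; rewrite -val_eqE /= inordK // => /negPf->; by rewrite mul0r.
by case: eqP; rewrite ?mul1r ?mul0r.
Qed.

Lemma entry_step_mulr i A s t : (t <= d)%N ->
  entry (A * step_mx i) s t
    = entry A s t + (if (0 < t)%N && (nth 0%N u t.-1 == i) then entry A s t.-1 else 0).
Proof.
move=> let_; rewrite /entry mxE.
under eq_bigr => j _ do rewrite mxE mulrDr inordK //.
rewrite big_split /= (bigD1 (inord t)) //= eqxx mulr1 big1 ?addr0; last first.
  by move=> j neq_j; rewrite (negPf neq_j) mulr0.
congr (_ + _); case: t let_ => [|t] let_ /=.
  by rewrite big1 // => j _; rewrite mulr0.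
rewrite (bigD1 (inord t)) //= inordK 1?ltnW // eqxx /= big1 ?addr0; last first.
  move=> j; rewrite -val_eqE /= inordK 1?ltnW // eqSS eq_sym => /negPf->; by rewrite mulr0.
by case: eqP; rewrite ?mulr1 ?mulr0.
Qed.

(** Binomial expansion of (1 + X_i)^e: the k-th power of X_i lives exactly on the runs of k letters
    i in [u]. *)
Lemma entry_step_exp i e s t : (s <= d)%N -> (t <= d)%N ->
  entry (step_mx i ^+ e) s t
    = if (s <= t)%N && all (pred1 i) (drop s (take t u)) then ('C(e, t - s))%:R else 0.
Proof.
move=> + let_; elim: e s => [|e IH] s les.
  rewrite expr0 entry_one //; case: ltngtP => //= [lts | ->].
    by rewrite -[(t - s)%N]prednK ?subn_gt0 // bin0n if_same.
  by rewrite subnn bin0 drop_oversize // size_take size_u; case: ltnP.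
rewrite exprS entry_step_mull // IH //.
case: (ltngtP s t) => [lts | ltt | eq_st] /=.
- have ltsd := leq_trans lts let_; rewrite ltsd IH // lts.
  rewrite (drop_nth 0%N) ?size_take ?size_u; last by case: (t < d)%N.
  rewrite nth_take //=; case: eqP => _ /=; last by rewrite addr0.
  case: all; last by rewrite addr0.
  by rewrite -natrD -[(t - s)%N]prednK ?subn_gt0 // binS -subnS.
- rewrite add0r; case: ifP => // /andP[ltsd _].
  by rewrite IH // leqNgt (leq_trans ltt).
have -> : drop s (take t u) = [::] by rewrite drop_oversize // size_take_min eq_st geq_minl.
rewrite /= eq_st subnn !bin0; case: ifP => [/andP[ltsd _] | _]; last by rewrite addr0.
by rewrite IH // ltnn addr0.
Qed.

End Band.

Lemma Zp_natr_dvd (q n : nat) : 1 < q -> ((n%:R)%R == 0%R :> 'Z_q) = (q %| n).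
Proof. by move=> q_gt1; rewrite -val_eqE /= val_Zp_nat. Qed.

Lemma Zp_natr_eq (q m n : nat) : 1 < q -> m = n %[mod q] -> (m%:R = n%:R :> 'Z_q)%R.
Proof. by move=> q_gt1 eqmn; apply: val_inj; rewrite /= !val_Zp_nat. Qed.

Section WordRepresentation.

Variables (q : nat) (u : seq nat) (E : nat -> nat).
Hypotheses (q_gt1 : 1 < q) (E_gt0 : forall i, 0 < E i).
(* Makes [(1 + X_i) ^ E i = 1] in the representation below. *)
Hypothesis dvd_run : forall i s t, s < t <= size u ->
  all (pred1 i) (drop s (take t u)) -> q %| 'C(E i, t - s).

Local Notation R := 'Z_q.
Local Notation d := (size u).
Local Notation M := 'M[R]_d.+1.
Local Notation H := {unit M}.

Lemma step_mx_exp i : (step_mx R d u i ^+ E i = 1 :> M)%R.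
Proof.
apply/matrixP=> s t; have := entry_step_exp R (erefl d) i (E i) (ltn_ord s) (ltn_ord t).
rewrite /entry !inord_val => ->; rewrite mxE -val_eqE /=.
case: ltngtP => [lts | // | eq_st] /=; last first.
  by rewrite eq_st subnn bin0 drop_oversize // size_take_min geq_minl.
case: ifP => // all_i; apply/eqP; rewrite Zp_natr_dvd //; apply: dvd_run all_i.
by rewrite lts; have := ltn_ord t.
Qed.

Lemma step_mx_unit i : (step_mx R d u i \is a GRing.unit)%R.
Proof. by rewrite -(unitrX_pos _ (E_gt0 i)) step_mx_exp unitr1. Qed.

Definition step_unit i : H := FinRing.Unit (step_mx_unit i).

Lemma step_unit_exp i : step_unit i ^+ E i = 1.
Proof. by apply: val_inj; rewrite FinRing.val_unitX step_mx_exp. Qed.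

Definition unip k : {set H} := [set A : H | [forall s : 'I_d.+1, forall t : 'I_d.+1,
   (t < s + k)%N ==> (((val A : M) - 1)%R s t == 0%R)]].

Lemma unipP k A : reflect (band k (val A - 1)%R) (A \in unip k).
Proof.
rewrite inE; apply: (iffP forallP) => [bA s t lets | bA s].
  by have /forallP/(_ t)/implyP/(_ lets)/eqP := bA s.
by apply/forallP=> t; apply/implyP=> lets; rewrite bA.
Qed.

Lemma unip_group_set k : group_set (unip k.+1).
Proof.
apply/group_setP; split=> [|A B /unipP bA /unipP bB]; apply/unipP.
  by rewrite subrr => s t _; rewrite mxE.
by rewrite FinRing.val_unitM; apply: band_unip_mul.
Qed.
Canonical unip_group k := Group (unip_group_set k).

(** [A, B] - 1 is A^-1 B^-1 (AB - BA), and AB - BA is the ring commutator of A - 1 and B - 1; the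
    unipotent factor in front only affects the next band. *)
Lemma unip_comm k A B : A \in unip k.+1 -> B \in unip 1 ->
  band k.+3 (val [~ A, B] - 1
    - ((val A - 1) * (val B - 1) - (val B - 1) * (val A - 1)))%R.
Proof.
move=> uA uB; have uA1 : A \in unip 1.
  by apply/unipP; apply: band_leq (unipP _ _ uA).
pose W := (A^-1 * B^-1)%g; pose C := ((val A - 1) * (val B - 1) - (val B - 1) * (val A - 1))%R.
have bC : band k.+2 C.
  apply: band_sub; first by rewrite -addn1; apply: band_mul; apply/unipP.
  by rewrite -add1n; apply: band_mul; apply/unipP.
have bW : band 1 (val W - 1)%R by apply/unipP; rewrite (@groupM _ (unip_group 0)) ?groupV.
suff -> : (val [~ A, B] - 1 = val W * C)%R by apply: band_mul1r.
have -> : [~ A, B] = W * (A * B) by rewrite commgEl conjgE /W !mulgA.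
have ringC (a b : M) : ((a + 1) * (b + 1) - (b + 1) * (a + 1) = a * b - b * a)%R.
  rewrite !mulrDl !mulrDr !mul1r !mulr1 -[(a * b + a + _)%R]addrA.
  have -> : (b * a + b + (a + 1) = (a + (b + 1)) + b * a)%R.
    by rewrite [RHS]addrC -addrA [in LHS](addrCA b).
  by rewrite addrKA.
have defC : (C = val A * val B - val B * val A)%R by rewrite /C -ringC !subrK.
rewrite defC mulrBr -!FinRing.val_unitM; congr (_ - _)%R.
have -> : W * (B * A) = 1 by rewrite /W !mulgA mulgKV mulVg.
by rewrite FinRing.val_unit1.
Qed.

Lemma unip_leq j k A : j <= k -> A \in unip k -> A \in unip j.
Proof. by move=> lejk /unipP bA; apply/unipP; apply: band_leq bA. Qed.

Lemma unip_commS k A B : A \in unip k.+1 -> B \in unip 1 -> [~ A, B] \in unip k.+2.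
Proof.
move=> uA uB; apply/unipP; have uA1 := unip_leq (ltn0Sn k) uA.
set C := ((val A - 1) * (val B - 1) - (val B - 1) * (val A - 1))%R.
rewrite -[(val _ - 1)%R](subrK C); apply: band_add.
  by apply: band_leq (unip_comm uA uB).
apply: band_sub; first by rewrite -addn1; apply: band_mul; apply/unipP.
by rewrite -add1n; apply: band_mul; apply/unipP.
Qed.

Lemma lcn_unip (K : {group H}) k : K \subset unip 1 -> 'L_k.+1(K) \subset unip k.+1.
Proof.
move=> uK; elim: k => [|k IH]; first by rewrite lcn1.
rewrite lcnSn (@gen_subG _ _ (unip_group k.+1)); apply/subsetP=> _ /imset2P[A B LA KB ->].
by apply: unip_commS; [apply: (subsetP IH) | apply: (subsetP uK)].
Qed.

Lemma unip_triv k A : d < k -> A \in unip k -> A = 1.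
Proof.
move=> ltdk /unipP bA; apply/val_inj; rewrite FinRing.val_unit1.
apply/matrixP=> s t; apply/eqP; rewrite -subr_eq0; apply/eqP.
have := bA s t; rewrite !mxE => -> //.
by rewrite (leq_trans (ltn_ord t)) // (leq_trans ltdk) // leq_addl.
Qed.

Lemma step_unit_unip i : step_unit i \in unip 1.
Proof. by apply/unipP; apply: step_mx_band. Qed.

Lemma entry_unip k A s t : A \in unip k -> s <= d -> t <= d -> t < s + k ->
  entry (val A) s t = ((s == t)%:R)%R.
Proof.
move=> uA les let_ lets; rewrite -(entry_one R les let_) /entry; apply/eqP.
rewrite -subr_eq0; apply/eqP; have := unipP _ _ uA (inord s) (inord t).
by rewrite !mxE !inordK // => ->.
Qed.

Lemma entry_unip_mul k A B s : A \in unip k.+1 -> B \in unip k.+1 -> s + k.+1 <= d ->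
  (entry (val (A * B)%g) s (s + k.+1) = entry (val A) s (s + k.+1) + entry (val B) s (s + k.+1))%R.
Proof.
move=> uA uB led; have les : s <= d := leq_trans (leq_addr _ _) led.
have E0 : entry (1 : M)%R s (s + k.+1) = 0%R.
  by rewrite entry_one // -{1}[s]addn0 eqn_add2l.
have bAB : band k.+2 (val (A * B)%g - (val A + val B - 1))%R.
  have -> : (val (A * B)%g - (val A + val B - 1) = (val A - 1) * (val B - 1))%R.
    rewrite FinRing.val_unitM mulrBl !mulrBr !mul1r !mulr1.
    by rewrite !opprB opprD !addrA; congr (_ - _)%R; rewrite addrAC.
  apply: (@band_leq _ _ _ (k.+1 + k.+1)); first by rewrite addSn addnS !ltnS leq_addr.
  by apply: band_mul; apply/unipP.
by rewrite (band_entry bAB) // entry_sub entry_add E0 subr0.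
Qed.

Lemma entry_comm_step k A i s : A \in unip k.+1 -> s + k.+2 <= d ->
  (entry (val [~ A, step_unit i]%g) s (s + k.+2)
    = (if nth 0%N u (s + k.+1) == i then entry (val A) s (s + k.+1) else 0)
      - (if nth 0%N u s == i then entry (val A) s.+1 (s.+1 + k.+1) else 0))%R.
Proof.
move=> uA led; have ltsd : s < d by apply: leq_trans led; rewrite addnS ltnS leq_addr.
have les := ltnW ltsd.
have lt1 : s + k.+1 <= d by apply: leq_trans led; rewrite leq_add2l.
have E1 a b : a < b -> b <= d -> entry (1 : M)%R a b = 0%R.
  by move=> ltab leb; rewrite entry_one ?(ltn_eqF ltab) // ltnW // (leq_trans ltab).
have lts a m : a < a + m.+1 by rewrite -{1}[a]addn0 ltn_add2l.
have := band_entry (unip_comm uA (step_unit_unip i)) les led (leqnn _).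
set a := (val A - 1)%R; set b := (val (step_unit i) - 1)%R.
have Ea m n : m < n -> n <= d -> entry a m n = entry (val A) m n.
  by move=> ltmn len; rewrite entry_sub E1 ?subr0.
have -> : (a * b = a * step_mx R d u i - a)%R by rewrite mulrBr mulr1.
have -> : (b * a = step_mx R d u i * a - a)%R by rewrite mulrBl mul1r.
rewrite [LHS]entry_sub E1 ?lts // subr0 => ->.
rewrite entry_sub [entry (a * _ - a)%R _ _]entry_sub [entry (_ * a - a)%R _ _]entry_sub.
have addKr' (x y : R) : (x + y - x = y)%R by rewrite addrC addKr.
rewrite entry_step_mulr // entry_step_mull // !addKr'.
have Eb : entry a s.+1 (s + k.+1).+1 = entry (val A) s.+1 (s.+1 + k.+1).
  by rewrite Ea ?ltnS ?lts ?addSn // -addnS.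
by rewrite addnS ltsd /= Eb Ea.
Qed.

Variables (gT : finGroupType) (G : {group gT}) (x : nat -> gT) (f : {morphism G >-> H}).
Hypotheses (Gx : forall i, x i \in G) (fx : forall i, f (x i) = step_unit i).
Hypothesis uG : f @* G \subset unip 1.

Lemma morph_lcn_unip k g : g \in 'L_k.+1(G) -> f g \in unip k.+1.
Proof.
move=> Lg; apply: (subsetP (lcn_unip k uG)).
rewrite -morphim_lcn // mem_morphim // (subsetP (lcn_sub _ _) _ Lg) //.
Qed.

(** On the leading superdiagonal group commutators are ring commutators, which yields the recursion
    of [bracket_sum]: the new letter is matched with the last or the first letter of the subword. *)
Lemma entry_word_comm v s : v != [::] -> s + size v <= d ->
  entry (val (f (word_comm x v))) s (s + size v)
    = bracket_sum (fun w => ((w == take (size v) (drop s u))%:R : R)%R) v.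
Proof.
elim/last_ind: v s => // v i IH s _.
case: (eqVneq v [::]) => [-> | v_n0].
  rewrite bracket_sum1 /= addn1 => ltsd; rewrite fx.
  have := @entry_step_mull R d u i 1%R s s.+1 (ltnW ltsd).
  rewrite mulr1 ltsd /= => ->; rewrite !entry_one // 1?ltnW // (ltn_eqF (ltnSn s)) add0r eqxx.
  by rewrite (drop_nth 0%N) //= take0 eqseq_cons eqxx andbT eq_sym; case: eqP.
have [k def_k] : exists k, size v = k.+1 by case: (v) v_n0 => // j w _; exists (size w).
rewrite size_rcons def_k => led.
have led1 : s + size v <= d by rewrite def_k (leq_trans _ led) // leq_add2l.
have led2 : s.+1 + size v <= d by rewrite def_k addSn -addnS.
have Lv := word_comm_mem Gx v_n0.
have Gv : word_comm x v \in G by apply: (subsetP (lcn_sub (size v) G)).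
rewrite word_comm_rcons // morphR // fx.
rewrite entry_comm_step //; last by apply: morph_lcn_unip; rewrite -def_k.
rewrite bracket_sum_rcons // -def_k !IH //.
have lt_sk : s + k.+1 < d by rewrite -addnS.
have szt : size (take (size v) (drop s u)) = size v.
  by rewrite size_takel // size_drop leq_subRL ?(leq_trans (leq_addr _ _) led1).
congr (_ - _)%R.
  have -> : take (size v).+1 (drop s u) = rcons (take (size v) (drop s u)) (nth 0%N u (s + k.+1)).
    by rewrite (take_nth 0%N) ?nth_drop ?def_k // size_drop ltn_subRL.
  rewrite /bracket_sum; case: eqP => [<- | neq_i].
    by apply: eq_bigr => e _; rewrite eqseq_rcons -def_k eqxx andbT.
  rewrite big1 // => e _; rewrite eqseq_rcons -def_k [i == _]eq_sym.
  by move/eqP/negPf: neq_i => ->; rewrite andbF mul0rz.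
rewrite (@drop_nth _ 0%N s u) ?(leq_trans _ lt_sk) ?ltnS ?leq_addr //=.
rewrite /bracket_sum; case: eqP => [<- | neq_i].
  by apply: eq_bigr => e _; rewrite eqseq_cons eqxx.
rewrite big1 // => e _; rewrite eqseq_cons [i == _]eq_sym.
by move/eqP/negPf: neq_i => ->; rewrite mul0rz.
Qed.

End WordRepresentation.

(** * Skew translations and the prime 2 *)

Section SkewTranslations.

Variables (q Q : nat).
Hypotheses (q_gt1 : 1 < q) (Q_gt1 : 1 < Q).

Local Notation A := {ffun 'Z_q -> 'Z_Q}.
Local Notation T := ('Z_q * 'Z_Q)%type.
Implicit Types (m : 'Z_q) (h : A).

(** Functions from Z/q to Z/Q extended by the translations of Z/q. Commutation with a translation is
    a finite difference, so a bound on the degree of the functions bounds the class. *)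
Definition skew_fun m h (z : T) : T := (z.1 + m, z.2 + h z.1)%R.

Lemma skew_fun_inj m h : injective (skew_fun m h).
Proof.
move=> [k v] [k' v'] eqz.
have ek : k = k' by apply: (addIr m); apply: (congr1 fst eqz).
by move: (congr1 snd eqz); rewrite /= ek => /addIr ->.
Qed.

Definition skew m h : {perm T} := perm (@skew_fun_inj m h).

Definition shift m h : A := [ffun k => h (k + m)%R].
Definition fdiff h : A := (shift 1%R h - h)%R.

Lemma skewE m h k v : skew m h (k, v) = (k + m, v + h k)%R.
Proof. by rewrite permE. Qed.

Lemma skewM m m' h h' : skew m h * skew m' h' = skew (m + m')%R (h + shift m h')%R.
Proof. by apply/permP=> -[k v]; rewrite permM !skewE !ffunE !addrA. Qed.

Lemma skew1 : skew 0%R 0%R = 1.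
Proof. by apply/permP=> -[k v]; rewrite perm1 skewE ffunE !addr0. Qed.

Lemma fdiffE h k : fdiff h k = (h (k + 1) - h k)%R.
Proof. by rewrite !ffunE. Qed.

Lemma shiftD m h h' : shift m (h + h')%R = (shift m h + shift m h')%R.
Proof. by apply/ffunP=> k; rewrite !ffunE. Qed.

Lemma shiftN m h : shift m (- h)%R = (- shift m h)%R.
Proof. by apply/ffunP=> k; rewrite !ffunE. Qed.

Lemma shift_shift m m' h : shift m (shift m' h) = shift (m + m')%R h.
Proof. by apply/ffunP=> k; rewrite !ffunE addrA. Qed.

Lemma shift0 h : shift 0%R h = h.
Proof. by apply/ffunP=> k; rewrite !ffunE addr0. Qed.

Lemma fdiffD h h' : fdiff (h + h')%R = (fdiff h + fdiff h')%R.
Proof. by rewrite /fdiff shiftD opprD addrACA. Qed.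

Lemma fdiffN h : fdiff (- h)%R = (- fdiff h)%R.
Proof. by rewrite /fdiff shiftN opprD. Qed.

Lemma fdiff_shift m h : fdiff (shift m h) = shift m (fdiff h).
Proof. by rewrite /fdiff shiftD shiftN !shift_shift addrC [in RHS]addrC [(m + _)%R]addrC. Qed.

(** Degree strictly below [j], in the sense of finite differences. *)
Definition deg_le j h := iter j fdiff h == 0%R.

Lemma deg_leD j h h' : deg_le j h -> deg_le j h' -> deg_le j (h + h')%R.
Proof.
rewrite /deg_le => /eqP h0 /eqP h'0.
suff -> : iter j fdiff (h + h')%R = (iter j fdiff h + iter j fdiff h')%R by rewrite h0 h'0 addr0.
by elim: j {h0 h'0} => //= j ->; rewrite fdiffD.
Qed.

Lemma deg_leN j h : deg_le j h -> deg_le j (- h)%R.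
Proof.
rewrite /deg_le => /eqP h0; suff -> : iter j fdiff (- h)%R = (- iter j fdiff h)%R by rewrite h0 oppr0.
by elim: j {h0} => //= j ->; rewrite fdiffN.
Qed.

Lemma iter_fdiff_shift j m h : iter j fdiff (shift m h) = shift m (iter j fdiff h).
Proof. by elim: j => //= j ->; rewrite fdiff_shift. Qed.

Lemma deg_le_shift j m h : deg_le j h -> deg_le j (shift m h).
Proof.
by rewrite /deg_le iter_fdiff_shift => /eqP->; apply/eqP/ffunP=> k; rewrite !ffunE.
Qed.

Lemma shift_fdiff0 m h : fdiff h = 0%R -> shift m h = h.
Proof.
move=> h0; have h1 : shift 1%R h = h by apply/eqP; rewrite -subr_eq0 -/(fdiff h) h0.
rewrite -[m]natr_Zp; elim: (m : nat) => [|n IH]; first exact: shift0.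
by rewrite -natr1 -shift_shift h1.
Qed.

Lemma deg_le_sub_shift j m h : deg_le j.+1 h -> deg_le j (shift m h - h)%R.
Proof.
rewrite /deg_le iterS => /eqP h0.
have itD h1 h2 : iter j fdiff (h1 - h2)%R = (iter j fdiff h1 - iter j fdiff h2)%R.
  by elim: j {h0} => //= j ->; rewrite fdiffD fdiffN.
by rewrite itD iter_fdiff_shift (shift_fdiff0 m h0) subrr.
Qed.

Definition skew_set j : {set {perm T}} := [set skew 0%R h | h in [set h : A | deg_le j h]].
Definition skew_top : {set {perm T}} := [set skew z.1 z.2 | z in [set z : 'Z_q * A | deg_le 3 z.2]].

Lemma skew_setP j s : reflect (exists2 h, deg_le j h & s = skew 0%R h) (s \in skew_set j).
Proof.
by apply: (iffP imsetP) => -[h]; rewrite ?inE => dh ->; exists h; rewrite ?inE.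
Qed.

Lemma skew_topP s : reflect (exists m, exists2 h, deg_le 3 h & s = skew m h) (s \in skew_top).
Proof.
apply: (iffP imsetP) => [[[m h]] | [m [h dh ->]]].
  by rewrite inE => dh ->; exists m, h.
by exists (m, h); rewrite ?inE.
Qed.

Lemma deg_le0 j : deg_le j 0%R.
Proof.
rewrite /deg_le; elim: j => //= j /eqP->; apply/eqP/ffunP=> k.
by rewrite !ffunE subrr.
Qed.

Lemma skew_set_group_set j : group_set (skew_set j).
Proof.
apply/group_setP; split=> [|s s' /skew_setP[h dh ->] /skew_setP[h' dh' ->]].
  by apply/skew_setP; exists 0%R; rewrite ?skew1 ?deg_le0.
apply/skew_setP; exists (h + shift 0%R h')%R; last by rewrite skewM addr0.
by rewrite shift0 deg_leD.
Qed.
Canonical skew_group j := Group (skew_set_group_set j).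

Lemma skew_top_group_set : group_set skew_top.
Proof.
apply/group_setP; split=> [|s s' /skew_topP[m [h dh ->]] /skew_topP[m' [h' dh' ->]]].
  by apply/skew_topP; exists 0%R, 0%R; rewrite ?skew1 ?deg_le0.
apply/skew_topP; exists (m + m')%R, (h + shift m h')%R; last by rewrite skewM.
by rewrite deg_leD ?deg_le_shift.
Qed.
Canonical skew_top_group := Group skew_top_group_set.

Lemma commg_skew m m' h h' :
  [~ skew m h, skew m' h']
    = skew 0%R (shift (- (m + m'))%R ((shift m h' - h') - (shift m' h - h)))%R.
Proof.
apply: (mulgI (skew m' h' * skew m h)); rewrite commgEl conjgE !mulgA.
rewrite mulgK mulgV mul1g !skewM addr0 [(m' + m)%R]addrC shift_shift subrr shift0.
congr (skew _ _); rewrite opprB [RHS]addrACA.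
by rewrite [(h' + (_ - _))%R]addrC subrK [(_ + (h - _))%R]addrC subrK addrC.
Qed.

Lemma skew_comm_top : [~: skew_top, skew_top] \subset skew_set 2.
Proof.
rewrite (@gen_subG _ _ (skew_group 2)).
apply/subsetP=> _ /imset2P[_ _ /skew_topP[m [h dh ->]] /skew_topP[m' [h' dh' ->]] ->].
apply/skew_setP; rewrite commg_skew; set g := shift _ _; exists g => //.
by apply/deg_le_shift/deg_leD; rewrite ?deg_leN ?deg_le_sub_shift.
Qed.

Lemma skew_comm_set j : [~: skew_set j.+1, skew_top] \subset skew_set j.
Proof.
rewrite (@gen_subG _ _ (skew_group j)).
apply/subsetP=> _ /imset2P[_ _ /skew_setP[h dh ->] /skew_topP[m' [h' dh' ->]] ->].
apply/skew_setP; rewrite commg_skew; set g := shift _ _; exists g => //.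
apply/deg_le_shift; rewrite shift0 subrr sub0r; exact/deg_leN/deg_le_sub_shift.
Qed.

Lemma skew_lcn (K : {group {perm T}}) : K \subset skew_top ->
  'L_2(K) \subset skew_set 2 /\ 'L_3(K) \subset skew_set 1 /\ 'L_4(K) = 1.
Proof.
move=> sK.
have L2 : 'L_2(K) \subset skew_set 2.
  by rewrite lcn2; apply: subset_trans (commgSS sK sK) skew_comm_top.
have L3 : 'L_3(K) \subset skew_set 1.
  by rewrite lcnSn; apply: subset_trans (commgSS L2 sK) (skew_comm_set 1).
have L4 : 'L_4(K) \subset skew_set 0.
  by rewrite lcnSn; apply: subset_trans (commgSS L3 sK) (skew_comm_set 0).
split=> //; split=> //; apply/trivgP; apply: subset_trans L4 _.
by apply/subsetP=> _ /skew_setP[h /eqP /= -> ->]; rewrite skew1 inE.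
Qed.

(** Plays the role of a matrix entry in degree 2: additive on [skew_set 2] and zero on
    [skew_set 1]. *)
Definition slope (s : {perm T}) : 'Z_Q := ((s (1, 0)).2 - (s (0, 0)).2)%R.

Lemma slope_skew m h : slope (skew m h) = fdiff h 0%R.
Proof. by rewrite /slope !skewE !ffunE /= !add0r. Qed.

Lemma slopeM s s' : s \in skew_set 2 -> s' \in skew_set 2 ->
  slope (s * s') = (slope s + slope s')%R.
Proof.
move=> /skew_setP[h dh ->] /skew_setP[h' dh' ->].
by rewrite skewM !slope_skew shift0 fdiffD ffunE.
Qed.

Lemma slope0 s : s \in skew_set 1 -> slope s = 0%R.
Proof. by move=> /skew_setP[h /eqP dh ->]; rewrite slope_skew [fdiff h]dh ffunE. Qed.

Lemma slope_commute s : s \in skew_set 2 -> commute s (skew 1%R 0%R) -> slope s = 0%R.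
Proof.
move=> /skew_setP[h dh ->]; rewrite /commute !skewM !addr0 add0r.
have -> : shift 0%R (0 : A)%R = 0%R by apply: shift0.
move/(congr1 (fun s : {perm T} => (s (0, 0)%R).2)).
rewrite slope_skew !skewE !ffunE /= !add0r addr0 => ->; rewrite subrr.
by [].
Qed.

Lemma skewX m h e : skew m h ^+ e = skew (m *+ e)%R (\sum_(j < e) shift (m *+ j) h)%R.
Proof.
elim: e => [|e IH]; first by rewrite big_ord0 mulr0n skew1.
by rewrite expgSr IH skewM mulrSr big_ord_recr.
Qed.

End SkewTranslations.

Section DihedralType.

Variable a : nat.
Hypothesis a_gt0 : 0 < a.

Let q := (2 ^ a)%N.
(** The commutator of the two generators has slope 4, whose additive order modulo 4q is exactly q:
    nothing is lost. *)
Let Q := (4 * q)%N.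

Lemma two_pow_gt1 : 1 < q. Proof. by rewrite -(expn0 2) ltn_exp2l. Qed.
Lemma four_two_pow_gt1 : 1 < Q. Proof. by rewrite /Q; have := two_pow_gt1; lia. Qed.

(* Chosen so that the second difference is 4 while, modulo [Q = 4q], the function
   is q-periodic and sums to 0 over a period: 2n(n - q) + (q - 1)^2. *)
Definition parabola n := (2 * n * n + 2 * q * n + (q - 1) * (q - 1))%N.

Definition parabola_fun : {ffun 'Z_q -> 'Z_Q} := [ffun k : 'Z_q => (parabola k)%:R%R].

Lemma parabola_funE n : parabola_fun (n%:R)%R = (parabola n)%:R%R.
Proof.
rewrite ffunE; apply: Zp_natr_eq four_two_pow_gt1 _; rewrite val_Zp_nat ?two_pow_gt1 //.
rewrite {2}(divn_eq n q); elim: (n %/ q) => [|m IH] //.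
rewrite IH; set s := (m * q + n %% q)%N.
have -> : (m.+1 * q + n %% q)%N = (s + q)%N by rewrite /s mulSn; lia.
have -> : parabola (s + q) = (parabola s + (s + q) * Q)%N by rewrite /parabola /Q; nia.
by rewrite addnC modnMDl.
Qed.

Lemma parabola_fdiff n : fdiff parabola_fun (n%:R)%R = (4 * n + 2 + 2 * q)%:R%R.
Proof.
rewrite fdiffE natr1 !parabola_funE.
have -> : parabola n.+1 = (4 * n + 2 + 2 * q + parabola n)%N by rewrite /parabola; lia.
by rewrite natrD addrK.
Qed.

Lemma parabola_fdiff2 n : fdiff (fdiff parabola_fun) (n%:R)%R = 4%:R%R.
Proof.
rewrite fdiffE natr1 !parabola_fdiff.
have -> : (4 * n.+1 + 2 + 2 * q = 4 + (4 * n + 2 + 2 * q))%N by lia.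
by rewrite natrD addrK.
Qed.

Lemma parabola_deg : deg_le 3 parabola_fun.
Proof.
apply/eqP/ffunP=> k; rewrite /= fdiffE [RHS]ffunE -[k]natr_Zp natr1 !parabola_fdiff2.
exact: subrr.
Qed.

Lemma parabola_sum : Q %| \sum_(j < q) parabola j.
Proof.
have [q' def_q] : exists q', q = q'.+1 by exists q.-1; rewrite prednK // ltnW ?two_pow_gt1.
(* Three times the sum has a closed form, and 3 is prime to Q. At n = q - 1 it equals Q (q - 1)(2q -
   1). *)
have eq3 n : (3 * \sum_(j < n.+1) parabola j
    = n.+1 * n * (2 * n + 1) + 3 * q * n.+1 * n + 3 * n.+1 * (q' * q'))%N.
  elim: n => [|n IH]; first by rewrite big_ord1 /parabola def_q subn1 /=; lia.
  rewrite big_ord_recr /= mulnDr IH /parabola def_q subn1 /=; nia.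
have co3 : coprime Q 3 by rewrite /Q coprimeMl /q coprimeXl.
rewrite -(Gauss_dvdr _ co3); have := eq3 q'; rewrite -def_q => ->.
apply/dvdnP; exists (q' * (2 * q' + 1))%N; rewrite /Q def_q; nia.
Qed.

Let y1 := skew (1 : 'Z_q)%R (0 : {ffun 'Z_q -> 'Z_Q})%R.
Let y2 := skew (1 : 'Z_q)%R parabola_fun.

Lemma sum_Zp (V : nmodType) (F : 'Z_q -> V) :
  (\sum_(j < q) F j%:R = \sum_(z : 'Z_q) F z)%R.
Proof.
have eq_range n m (F' : nat -> V) : n = m ->
    (\sum_(0 <= j < n) F' j = \sum_(0 <= j < m) F' j)%R by move->.
rewrite -(big_mkord xpredT (fun j => F j%:R%R)) (eq_range _ _ _ (esym (Zp_cast two_pow_gt1))).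
by rewrite big_mkord; apply: eq_bigr => j _; rewrite natr_Zp.
Qed.

Lemma skew_exp_q (h : {ffun 'Z_q -> 'Z_Q}) :
  (\sum_(j < q) h j%:R = 0)%R -> skew 1%R h ^+ q = 1.
Proof.
move=> sum0; rewrite skewX.
have -> : ((1 : 'Z_q) *+ q = 0)%R by apply/eqP; rewrite Zp_natr_dvd ?two_pow_gt1.
rewrite -[RHS]skew1; congr skew; apply/ffunP=> k; rewrite sum_ffunE ffunE -[RHS]sum0.
under eq_bigr => j _ do rewrite ffunE.
by rewrite (sum_Zp (fun z => h (k + z)%R)) sum_Zp [RHS](reindex_inj (addrI k)).
Qed.

Lemma skew_shift_exp : y1 ^+ q = 1.
Proof. by apply: skew_exp_q; rewrite big1 // => j _; rewrite ffunE. Qed.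

Lemma skew_parabola_exp : y2 ^+ q = 1.
Proof.
apply: skew_exp_q; under eq_bigr => j _ do rewrite parabola_funE.
by rewrite -natr_sum; apply/eqP; rewrite Zp_natr_dvd ?four_two_pow_gt1 // parabola_sum.
Qed.

Lemma skew_shift_top : y1 \in skew_top q Q.
Proof. by apply/skew_topP; exists 1%R, 0%R; rewrite ?deg_le0. Qed.

Lemma skew_parabola_top : y2 \in skew_top q Q.
Proof. by apply/skew_topP; exists 1%R, parabola_fun; rewrite ?parabola_deg. Qed.

Lemma slope_parabola : slope [~ y1, y2] = (4%:R)%R.
Proof.
rewrite /y1 /y2 commg_skew slope_skew.
set m := (- (1 + 1))%R.
have -> : shift 1%R (0 : {ffun 'Z_q -> 'Z_Q})%R = 0%R by apply/ffunP=> k; rewrite !ffunE.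
rewrite subrr subr0 -/(fdiff parabola_fun) fdiff_shift ffunE add0r.
by rewrite -[m]natr_Zp parabola_fdiff2.
Qed.

End DihedralType.

(** Used with three functionals: the class in L_n / L_(n+1), a matrix entry, and the slope. *)
Lemma lcn_transfer (gT : finGroupType) (G : {group gT}) (x : nat -> gT) (V : zmodType)
    (psi : gT -> V) n c (L : seq (seq nat)) :
    (forall i, x i \in G) ->
    (forall g h, g \in 'L_n(G) -> h \in 'L_n(G) -> psi (g * h) = (psi g + psi h)%R) ->
    (forall g, g \in 'L_n.+1(G) -> psi g = 0%R) ->
    0 < n -> c \in 'L_n(G) -> all (fun v => size v == n) L ->
    c^-1 * \prod_(v <- L) word_comm x v \in 'L_n.+1(G) ->
  psi c = (\sum_(v <- L) psi (word_comm x v))%R.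
Proof.
move=> Gx psiM psi0 n_gt0 Lc sL cL.
have L_cw v : v \in L -> word_comm x v \in 'L_n(G).
  move/(allP sL)/eqP => sz_v; rewrite -sz_v word_comm_mem // -size_eq0 sz_v.
  by rewrite -lt0n.
have [Lprod <-] : \prod_(v <- L) word_comm x v \in 'L_n(G) /\
    psi (\prod_(v <- L) word_comm x v) = (\sum_(v <- L) psi (word_comm x v))%R.
  rewrite !big_seq; elim/big_ind2: _ => [|g a h b [Lg <-] [Lh <-] | v /L_cw //].
    by rewrite group1 psi0 ?group1.
  by rewrite groupM // psiM.
rewrite -[\prod_(v <- L) _](mulKVg c) psiM ?(psi0 _ cL) ?addr0 //.
exact: (subsetP (lcn_subS n G)).
Qed.

Lemma lcn_word_span (gT : finGroupType) (G : {group gT}) (x : nat -> gT) (S : {set gT}) n c :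
    (forall i, x i \in G) -> G :=: <<S>> -> (forall s, s \in S -> exists i, s = x i) ->
    0 < n -> c \in 'L_n(G) ->
  exists2 L : seq (seq nat), all (fun v => size v == n) L &
    c^-1 * \prod_(v <- L) word_comm x v \in 'L_n.+1(G).
Proof.
move=> Gx genG defS n_gt0 Lc; have [A [cl [clM cl0 cl_inj]]] := lcn_factor_zmod G n.
have [L sL def_c] := word_comm_span Gx clM cl0 genG defS n_gt0 Lc.
exists L => //.
have L_cw v : v \in L -> word_comm x v \in 'L_n(G).
  move/(allP sL)/eqP => sz_v; rewrite -sz_v word_comm_mem // -size_eq0 sz_v.
  by rewrite -lt0n.
have [Lprod def_prod] : \prod_(v <- L) word_comm x v \in 'L_n(G) /\
    cl (\prod_(v <- L) word_comm x v) = (\sum_(v <- L) cl (word_comm x v))%R.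
  rewrite !big_seq; elim/big_ind2: _ => [|g a h b [Lg <-] [Lh <-] | v /L_cw //].
    by rewrite group1 cl0 ?group1.
  by rewrite groupM // clM.
apply: cl_inj; first by rewrite groupM ?groupV.
rewrite clM ?groupV // def_prod -def_c -clM ?groupV // mulVg.
by rewrite cl0 ?group1.
Qed.

(** * Matrix entries as word coefficients, and the effect of commuting with a generator *)

Section WordCoefficients.

Variables (q : nat) (u : seq nat) (E : nat -> nat).
Hypotheses (q_gt1 : 1 < q) (E_gt0 : forall i, 0 < E i).
Hypothesis dvd_run : forall i s t, s < t <= size u ->
  all (pred1 i) (drop s (take t u)) -> q %| 'C(E i, t - s).

Local Notation R := 'Z_q.
Local Notation d := (size u).
Local Notation M := 'M[R]_d.+1.
Local Notation H := {unit M}.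
Local Notation step := (step_unit q_gt1 E_gt0 dvd_run).

Lemma step_unit_notin i : i \notin u -> step i = 1.
Proof.
move=> u'i; apply: val_inj; rewrite FinRing.val_unit1; apply/matrixP=> s t.
rewrite !mxE; suff -> : (t == s.+1 :> nat) && (nth 0%N u s == i) = false by rewrite addr0.
apply/andP=> -[/eqP def_t /eqP def_i]; case/negP: u'i.
by rewrite -def_i mem_nth // -ltnS -def_t.
Qed.

Variables (gT : finGroupType) (G : {group gT}) (x : nat -> gT) (f : {morphism G >-> H}).
Hypotheses (Gx : forall i, x i \in G) (fx : forall i, f (x i) = step i).
Hypothesis uG : f @* G \subset unip q u 1.

(** Along a run of the letter i only the factors [x i] contribute, so the order of the product does
    not matter: the entry is that of a power of 1 + X_i. *)
Lemma entry_prod i l s t : s <= t -> t <= d -> all (pred1 i) (drop s (take t u)) ->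
  entry (val (f (\prod_(j <- l) x j))) s t = ('C(count_mem i l, t - s))%:R%R.
Proof.
have Gl l' : \prod_(j <- l') x j \in G by rewrite group_prod.
move=> + let_; elim: l s => [|j l IH] s lest all_i.
  have les := leq_trans lest let_.
  rewrite big_nil morph1 FinRing.val_unit1 entry_one // bin0n subn_eq0.
  by rewrite eqn_leq lest andTb.
have les := leq_trans lest let_.
rewrite big_cons morphM // FinRing.val_unitM fx entry_step_mull // IH //.
move: lest; rewrite leq_eqVlt => /predU1P[eq_st | ltst].
  rewrite eq_st subnn !bin0; case: ifP => [/andP[ltsd _] | _]; last by rewrite addr0.
  have ul : f (\prod_(j <- l) x j) \in unip q u 1 by apply: (subsetP uG); rewrite mem_morphim.
  by rewrite (entry_unip ul) // ?(gtn_eqF (ltnSn t)) ?addr0 // addn1 ltnS leqnSn.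
have ltsd := leq_trans ltst let_; move: all_i.
rewrite (drop_nth 0%N) ?size_take; last by case: (t < d).
rewrite nth_take //= => /andP[/eqP nth_i all_i].
rewrite ltsd /= nth_i eq_sym IH //; case: eqP => _; last by rewrite addr0.
rewrite -natrD -[X in 'C(_, X)]prednK ?subn_gt0 //.
by rewrite add1n -[in RHS](prednK (_ : 0 < t - s)) ?subn_gt0 // binS -subnS.
Qed.

(** Both products [g * x j] and [x j * g] have the entry (0, d) of g as a summand; cancelling it
    leaves the two shorter entries. *)
Lemma comm_entry n g j : d = n.+1 -> g \in G -> commute g (x j) ->
  ((if nth 0%N u n == j then entry (val (f g)) 0 n else 0)
    = (if nth 0%N u 0 == j then entry (val (f g)) 1 n.+1 else 0) :> R)%R.
Proof.
move=> sz_u Gg cgx; have : val (f (g * x j)) = val (f (x j * g)) by rewrite cgx.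
rewrite !morphM // !FinRing.val_unitM fx => /(congr1 (fun B : M => entry B 0 n.+1)).
have d_gt0 : 0 < d by rewrite sz_u.
rewrite entry_step_mulr ?sz_u // entry_step_mull // -/x d_gt0 /=.
exact: addrI.
Qed.

Lemma entry_coef n c (L : seq (seq nat)) s : 0 < n -> c \in 'L_n(G) ->
    all (fun v => size v == n) L -> c^-1 * \prod_(v <- L) word_comm x v \in 'L_n.+1(G) ->
    s + n <= d ->
  entry (val (f c)) s (s + n) = (word_coef L (take n (drop s u)))%:~R%R.
Proof.
case: n => // k _ Lc sL cL led.
have les : s <= d := leq_trans (leq_addr _ _) led.
have GL g : g \in 'L_k.+1(G) -> g \in G by apply/subsetP/lcn_sub.
have uL g : g \in 'L_k.+1(G) -> f g \in unip q u k.+1.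
  exact: (morph_lcn_unip uG).
have psiM g h : g \in 'L_k.+1(G) -> h \in 'L_k.+1(G) ->
    (entry (val (f (g * h)%g)) s (s + k.+1)
      = entry (val (f g)) s (s + k.+1) + entry (val (f h)) s (s + k.+1) :> R)%R.
  by move=> Lg Lh; rewrite morphM ?GL // (entry_unip_mul (uL g Lg) (uL h Lh)).
have psi0 g : g \in 'L_k.+2(G) -> (entry (val (f g)) s (s + k.+1) = 0 :> R)%R.
  move=> Lg; rewrite (entry_unip (morph_lcn_unip uG Lg)) ?ltn_add2l //.
  by rewrite -{1}[s]addn0 eqn_add2l.
rewrite (lcn_transfer Gx psiM psi0 _ Lc sL cL) // rmorph_sum.
apply: eq_big_seq => v /(allP sL)/eqP sz_v; rewrite -sz_v.
rewrite (entry_word_comm Gx fx uG); last 2 first; rewrite ?sz_v // -?size_eq0 ?sz_v //.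
rewrite /bracket_sum rmorph_sum; apply: eq_bigr => e _ /=.
by rewrite mulrzz rmorphM /= mulrzr; case: eqP.
Qed.

End WordCoefficients.

(** * Divisibility of binomial coefficients and runs of letters in words *)

Lemma mulrz_Zp_eq0 (A : zmodType) (a : A) (b q : nat) (z : int) : 0 < b -> 1 < q ->
  (a *+ q = 0 -> ((b%:R : 'Z_(b * q)) * z%:~R = 0) -> a *~ z = 0)%R.
Proof.
move=> b_gt0 q_gt1 aq0.
have bq_gt1 : 1 < b * q by rewrite (leq_trans q_gt1) ?leq_pmull.
have nat_case n : ((b%:R * n%:R : 'Z_(b * q)) == 0)%R -> (a *+ n = 0)%R.
  rewrite -natrM Zp_natr_dvd // dvdn_pmul2l // => /dvdnP[k ->].
  by rewrite mulnC mulrnA aq0 mul0rn.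
case: z => n /eqP; first by rewrite -!pmulrn; apply: nat_case.
by rewrite NegzE !mulrNz mulrN oppr_eq0 -!pmulrn => /nat_case->; rewrite oppr0.
Qed.

(** From p C(K, p) = K C(K-1, p-1), where C(K-1, p-1) is prime to p because K - 1, ..., K - p + 1
    are not divisible by p. *)
Lemma dvdn_mul_of_dvdn_bin p m K : prime p -> p %| K -> p ^ m %| 'C(K, p) -> p ^ m.+1 %| K.
Proof.
move=> p_pr; have p_gt0 := prime_gt0 p_pr; case: K => // K pK.
rewrite -(dvdn_pmul2l p_gt0) -expnS.
rewrite -[X in _ %| X * 'C(_, X)](prednK p_gt0) -mul_bin_diag Gauss_dvdl //=.
rewrite coprimeXl // prime_coprime //; apply/negP=> pC.
have : p %| \prod_(i < p.-1) (K - i).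
  by rewrite -ffact_prod -bin_ffact dvdn_mulr.
rewrite Euclid_dvd_prod // big_orE => /exists_inP[i _ p_Ki].
have ltiK : i < K.
  by apply: leq_trans (ltn_ord i) _; rewrite -ltnS prednK // dvdn_leq.
have : p %| i.+1 by rewrite -(dvdn_addr _ p_Ki) addnS subnK // ltnW.
by rewrite gtnNdvd // -ltn_predRL ltn_ord.
Qed.

(** In at most p + 1 letters a run of length p covers the positions 0 to p - 1 or 1 to p, and two
    distinct letters there exclude it. Such a run lies inside [u], so the default letter never
    interferes. *)
Lemma run_length_lt p u : size u <= p.+1 ->
    (exists a b, [/\ a < p, b < p & nth 0 u a != nth 0 u b]) ->
    (size u = p.+1 -> exists a b, [/\ a < p, b < p & nth 0 u a.+1 != nth 0 u b.+1]) ->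
  forall i s t, s < t <= size u -> all (pred1 i) (drop s (take t u)) -> t - s < p.
Proof.
move=> sz_u [a [b [lta ltb neq_ab]]] neq1 i s t /andP[ltst let_] all_i.
have nth_run k : s <= k < t -> nth 0 u k = i.
  case/andP=> lesk ltkt; apply/eqP.
  have -> : nth 0 u k = nth 0 (drop s (take t u)) (k - s).
    by rewrite nth_drop subnKC // nth_take.
  by apply: (allP all_i); rewrite mem_nth // size_drop size_takel // ltn_sub2r.
rewrite ltnNge; apply/negP=> lep.
have les1 : s <= 1 by lia.
case: s les1 => [|[|//]] _ in ltst all_i nth_run lep *.
  by case/eqP: neq_ab; rewrite !nth_run //; lia.
have [|a' [b' [lta' ltb' /eqP[]]]] := neq1; first lia.
by rewrite !nth_run //; lia.
Qed.

(* Fails for p = 2: both one-letter extensions of a word [:: h; l] contain a square. *)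
Lemma word_extension p w : 2 < p -> 1 < size w <= p -> ~~ all (pred1 (head 0 w)) w ->
  exists j u, [/\ j \in w, (u = rcons w j /\ nth 0 w 0 <> j) \/ (u = j :: w /\ last 0 w <> j)
    & forall i s t, s < t <= size u -> all (pred1 i) (drop s (take t u)) -> t - s < p].
Proof.
move=> p_gt2 /andP[w_gt1 le_wp] nconst; set h := nth 0 w 0; set l := last 0 w.
have lE : l = nth 0 w (size w).-1 by rewrite nth_last.
have right_run j a : a < size w -> nth 0 w 0 != j -> nth 0 w a != j \/ a = 0 ->
    (size w = p -> exists b, 0 < b < p /\ nth 0 w b != j) ->
    (size w = p -> exists b, b < p /\ nth 0 w b != nth 0 w 0) ->
  forall i s t, s < t <= size (rcons w j) ->
    all (pred1 i) (drop s (take t (rcons w j))) -> t - s < p.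
  move=> lta neq_h _ run1 run0; apply: run_length_lt; rewrite ?size_rcons //.
    have [eq_wp | neq_wp] := eqVneq (size w) p.
      have [b [ltb neq_b]] := run0 eq_wp; exists b, 0; split=> //; first lia.
      by rewrite !nth_rcons eq_wp ltb; have -> : 0 < p by lia.
    exists 0, (size w); split; [lia | lia |].
    by rewrite !nth_rcons ltnn eqxx; have -> : 0 < size w by lia.
  move=> [eq_wp]; have [b [/andP[b_gt0 ltb] neq_b]] := run1 eq_wp.
  exists b.-1, p.-1; split; [lia | lia |].
  rewrite !prednK //; last lia.
  by rewrite !nth_rcons eq_wp ltb ltnn eqxx.
have [eq_hl | neq_hl] := eqVneq h l.
  (* With equal ends, any other letter of [w] may be appended. *)
  have [j wj neq_jh] : exists2 j, j \in w & j != h.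
    by have /allPn[j wj neq] := nconst; exists j => //; rewrite /h nth0.
  have [a lta def_j] : exists2 a, a < size w & nth 0 w a = j.
    by exists (index j w); rewrite ?index_mem ?nth_index.
  exists j, (rcons w j); split=> //; first by left; split=> //; apply/eqP; rewrite eq_sym.
  apply: (right_run j 0) => //; [lia | by rewrite eq_sym | by right | |] => eq_wp.
    by exists p.-1; split; [lia | rewrite -eq_wp -lE -eq_hl eq_sym].
  by exists a; split; [lia | rewrite def_j].
(* Appending l to h l ... l could create a run of p letters, so when the second letter is l the
   letter h is prepended instead; the run h h is short because p > 2. *)
have [eq1 | neq1] := eqVneq (nth 0 w 1) l.
  exists h, (h :: w); split; first by rewrite mem_nth // ltnW.
    by right; split=> //; apply/eqP; rewrite eq_sym.
  apply: run_length_lt; rewrite //= ?ltnS //.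
    by exists 0, 2; split=> //; [lia | rewrite /= eq1].
  move=> [eq_wp]; exists 0, p.-1; split; [lia | lia |].
  by rewrite /= -eq_wp -lE.
exists l, (rcons w l); split; first by rewrite lE mem_nth // ltn_predL ltnW.
  by left; split=> //; apply/eqP.
apply: (right_run l 0) => //; [lia | by right | |] => eq_wp.
  by exists 1%N; split=> //; lia.
by exists p.-1; split; [lia | rewrite -eq_wp -lE eq_sym].
Qed.

(** * The nilpotent product *)

Section NilpotentProduct.

Variables (gT : finGroupType) (G : {group gT}) (p r : nat).
Variables (x0 : nat -> gT) (alpha : nat -> nat).
Hypotheses (p_pr : prime p) (r_gt1 : 1 < r).
Hypothesis alpha_gt0 : forall i, 0 < i <= r -> 0 < alpha i.
Hypothesis alpha_mono : forall i j, 0 < i -> i <= j -> j <= r -> alpha i <= alpha j.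
Hypothesis nilG : is_nil_prod p.+1 G r x0 (fun i => (p ^ alpha i)%N).

Let inr i := 0 < i <= r.
(** Extended by 1 so that every natural number is a letter; a simple commutator containing a letter
    out of range is trivial. *)
Let x i := if inr i then x0 i else 1.
Let E i := (p ^ alpha i)%N.
Let S := [set x0 i.+1 | i : 'I_r].

Let p_gt1 := prime_gt1 p_pr.

Lemma nil_gen : G :=: <<S>>. Proof. by case: nilG. Qed.

Lemma nil_genP s : s \in S -> exists2 i, inr i & s = x i.
Proof. by case/imsetP=> i _ ->; exists i.+1; rewrite /x /inr /= ltn_ord. Qed.

Lemma nil_x_mem i : x i \in G.
Proof.
rewrite /x; case: ifP => [/andP[]|_]; last exact: group1.
case: i => // i _ lti; rewrite nil_gen mem_gen //; apply/imsetP.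
by exists (Ordinal lti).
Qed.

Lemma nil_x_exp i : x i ^+ E i = 1.
Proof.
rewrite /x /E; case: ifP => [ir|_]; last exact: expg1n.
by case: nilG => _ /(_ i ir) <- _ _; rewrite expg_order.
Qed.

Lemma nil_class_le : 'L_p.+2(G) = 1. Proof. by case: nilG. Qed.

Lemma nil_E_gt0 i : 0 < E i. Proof. by rewrite expn_gt0 prime_gt0. Qed.

Lemma nil_morph (hT : finGroupType) (y : nat -> hT) (K : {group hT}) :
    (forall i, y i ^+ E i = 1) -> (forall i, ~~ inr i -> y i = 1) ->
    (forall i, y i \in K) -> 'L_p.+2(K) = 1 ->
  exists2 f : {morphism G >-> hT}, f @* G \subset K & forall i, f (x i) = y i.
Proof.
move=> yE y1 Ky LK; case: nilG => _ _ _ univ.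
have sYK : gen_by r y \subset K.
  by rewrite gen_subG; apply/subsetP=> _ /imsetP[i _ ->].
have [||f fx0] := univ hT y.
- by move=> i _; apply: yE.
- by apply/trivgP; rewrite -LK lcnS.
have fx i : f (x i) = y i.
  by rewrite /x; case: ifP => [/fx0 // | ir]; rewrite morph1 y1 // ir.
exists f => //; have sSG : S \subset G by rewrite nil_gen subset_gen.
have <- : f @* <<S>> = f @* G by rewrite -nil_gen.
rewrite morphim_gen // gen_subG; apply/subsetP=> _ /morphimP[s _ /nil_genP[i _ ->] ->].
by rewrite fx.
Qed.

(** The bound on [u] keeps the class at most p + 1. A nonempty run consists of letters of [u], so
    only their orders matter, and all other generators go to 1. *)
Lemma nil_matrix m u (m_gt0 : 0 < m) (uR : all inr u) (sz_u : size u <= p.+1)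
    (dvd_run : forall i s t, i \in u -> s < t <= size u ->
       all (pred1 i) (drop s (take t u)) -> p ^ m %| 'C(E i, t - s)) :
  exists (q_gt1 : 1 < p ^ m) (E_gt0 : forall i, 0 < E i) dvd_run',
  exists2 f : {morphism G >-> {unit 'M['Z_(p ^ m)]_((size u).+1)}},
    f @* G \subset unip (p ^ m) u 1 &
    forall i, f (x i) = @step_unit (p ^ m) u E q_gt1 E_gt0 dvd_run' i.
Proof.
have q_gt1 : 1 < p ^ m by rewrite -(expn0 p) ltn_exp2l.
have run' i s t : s < t <= size u ->
    all (pred1 i) (drop s (take t u)) -> p ^ m %| 'C(E i, t - s).
  move=> lst all_i; apply: dvd_run => //; case/andP: lst => ltst let_.
  have lts := leq_trans ltst let_.
  have : nth 0 u s \in drop s (take t u).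
    by rewrite (@drop_nth _ 0) ?size_takel // nth_take // mem_head.
  by move/(allP all_i)/eqP => <-; rewrite mem_nth.
exists q_gt1, nil_E_gt0, run'.
have [||||f uf fx] := @nil_morph _ (step_unit q_gt1 nil_E_gt0 run') (unip_group (p ^ m) u 0).
- exact: step_unit_exp.
- move=> i ir; apply: step_unit_notin; apply: contra ir; exact: (allP uR).
- exact: step_unit_unip.
- apply/trivgP/subsetP=> A LA; rewrite inE; apply/eqP.
  apply: (@unip_triv _ _ p.+2); first by rewrite ltnS.
  by apply: (subsetP (lcn_unip _ _)) LA.
by exists f.
Qed.

(* Commuting with [x j] kills the coefficient of [w] when [j] is inserted after
   (or before) [w], provided the other end of [w] is not [j]. *)
Lemma nil_coef_zero m n c (L : seq (seq nat)) w j u : 0 < m -> 0 < n <= p ->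
    size w = n -> c \in 'L_n(G) -> all (fun v => size v == n) L ->
    c^-1 * \prod_(v <- L) word_comm x v \in 'L_n.+1(G) ->
    commute c (x j) -> all inr u ->
    (u = rcons w j /\ nth 0 w 0 <> j) \/ (u = j :: w /\ last 0 w <> j) ->
    (forall i s t, i \in u -> s < t <= size u ->
       all (pred1 i) (drop s (take t u)) -> p ^ m %| 'C(E i, t - s)) ->
  ((word_coef L w)%:~R = 0 :> 'Z_(p ^ m))%R.
Proof.
move=> m_gt0 /andP[n_gt0 le_np] sz_w Lc sL cL ccx uR def_u dvd_run.
have sz_u : size u = n.+1 by case: def_u => -[-> _]; rewrite ?size_rcons /= sz_w.
have [|q_gt1 [E_gt0 [run' [f uf fx]]]] := nil_matrix m_gt0 uR _ dvd_run.
  by rewrite sz_u.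
have Gc : c \in G by apply: subsetP Lc; apply: lcn_sub.
have := comm_entry nil_x_mem fx sz_u Gc ccx.
have coef s := entry_coef nil_x_mem fx uf n_gt0 Lc sL cL (s := s).
case: def_u => -[def_u neq_j].
  have -> : nth 0 u n = j by rewrite def_u nth_rcons sz_w ltnn eqxx.
  have -> : nth 0 u 0 = nth 0 w 0 by rewrite def_u nth_rcons sz_w n_gt0.
  rewrite eqxx (introF eqP neq_j) => <-; rewrite -[n in RHS]add0n coef ?sz_u //.
  by rewrite drop0 def_u -cats1 take_size_cat.
have -> : nth 0 u n = last 0 w.
  by rewrite def_u -[in RHS](nth_last 0) sz_w -[n in LHS](prednK n_gt0).
have -> : nth 0 u 0 = j by rewrite def_u.
have led : 1 + n <= size u by rewrite sz_u.
have := coef 1%N led; rewrite eqxx (introF eqP neq_j) -[(1 + n)%N]/(n.+1) => -> /esym.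
by rewrite {1}def_u /= drop0 -{1}sz_w take_size.
Qed.

Lemma nil_dvd_run m u : (forall i, i \in u -> m <= alpha i) ->
    (forall i s t, s < t <= size u -> all (pred1 i) (drop s (take t u)) -> t - s < p) ->
  forall i s t, i \in u -> s < t <= size u ->
    all (pred1 i) (drop s (take t u)) -> p ^ m %| 'C(E i, t - s).
Proof.
move=> le_m run i s t ui lst all_i; apply: (@dvdn_trans (p ^ alpha i)).
  by rewrite dvdn_exp2l // le_m.
by rewrite dvdn_bin_pexp // (run i) // subn_gt0; case/andP: lst => ->.
Qed.

(* For p = 2 unitriangular matrices lose a factor 2 in degree 2; the group
   generated by [skew 1 0] and [skew 1 (parabola_fun m)] does not. *)
Lemma nil_coef_zero2 m c (L : seq (seq nat)) h l : p = 2 -> 0 < m ->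
    h != l -> inr h -> inr l -> m <= alpha h -> m <= alpha l ->
    c \in 'L_2(G) -> all (fun v => size v == 2) L ->
    c^-1 * \prod_(v <- L) word_comm x v \in 'L_3(G) -> commute c (x h) ->
  ((4%:R : 'Z_(4 * 2 ^ m)) * (word_coef L [:: h; l])%:~R = 0)%R.
Proof.
move=> p2 m_gt0 neq_hl hR lR le_mh le_ml Lc sL cL ccx.
pose q := (2 ^ m)%N; pose Q := (4 * q)%N.
pose y1 := skew (1 : 'Z_q)%R (0 : {ffun 'Z_q -> 'Z_Q})%R.
pose y2 := skew (1 : 'Z_q)%R (parabola_fun m).
pose y i := if i == h then y1 else if i == l then y2 else 1.
have y_top i : y i \in skew_top q Q.
  rewrite /y; case: eqP => _; first exact: skew_shift_top.
  by case: eqP => _; [exact: skew_parabola_top | exact: group1].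
have exp2 z i : z ^+ q = 1 -> m <= alpha i -> z ^+ E i = 1 :> {perm 'Z_q * 'Z_Q}.
  move=> zq le_m; have /dvdnP[k def_E] : q %| E i by rewrite /E p2 dvdn_exp2l.
  by rewrite def_E mulnC expgM zq expg1n.
have [||||f uf fx] := @nil_morph _ y (skew_top_group q Q) => //.
- move=> i; rewrite /y; case: eqP => [->|_]; first exact: exp2 (skew_shift_exp m_gt0) le_mh.
  by case: eqP => [->|_]; [exact: exp2 (skew_parabola_exp m_gt0) le_ml | exact: expg1n].
- move=> i ir; rewrite /y; case: eqP ir => [->|_]; first by rewrite hR.
  by case: eqP => [->|//]; rewrite lR.
- by rewrite p2; have [_ []] := skew_lcn (subxx (skew_top q Q)).
have [sL2 [sL3 _]] := skew_lcn uf.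
have GL g k : g \in 'L_k(G) -> g \in G by apply/subsetP/lcn_sub.
have fL2 g : g \in 'L_2(G) -> f g \in skew_set q Q 2.
  by move=> Lg; apply: (subsetP sL2); rewrite -morphim_lcn // mem_morphim // (GL g 2).
have fL3 g : g \in 'L_3(G) -> f g \in skew_set q Q 1.
  by move=> Lg; apply: (subsetP sL3); rewrite -morphim_lcn // mem_morphim // (GL g 3).
have c0 : slope (f c) = 0%R.
  apply: (slope_commute (fL2 c Lc)); rewrite -/y1.
  have <- : f (x h) = y1 by rewrite fx /y eqxx.
  by rewrite /commute -!morphM ?nil_x_mem ?(GL c 2) // ccx.
have slM a b : a \in 'L_2(G) -> b \in 'L_2(G) ->
    slope (f (a * b)) = (slope (f a) + slope (f b))%R.
  by move=> La Lb; rewrite morphM ?(GL _ 2) // (slopeM (fL2 a La) (fL2 b Lb)).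
have sl0 a : a \in 'L_3(G) -> slope (f a) = 0%R by move=> La; rewrite (slope0 (fL3 a La)).
(* It remains to see that the slope of each [x_i, x_j] is 4 times the coefficient of the word h l in
   its Lie polynomial. *)
rewrite -[RHS]c0 (lcn_transfer nil_x_mem slM sl0 _ Lc sL cL) // rmorph_sum mulr_sumr.
apply: eq_big_seq => v /(allP sL); case: v => [|i [|j []]] //= _.
rewrite morphR ?nil_x_mem // !fx.
rewrite /bracket_sum /= big_cons big_seq1 /= mulrNz !mulr1z.
rewrite !eqseq_cons !andbT.
have sl1 : slope (1 : {perm 'Z_q * 'Z_Q}) = 0%R by rewrite -(morph1 f) sl0 ?group1.
have sl11 (z : {perm 'Z_q * 'Z_Q}) : slope [~ z, z] = 0%R by rewrite commgg.
have sl1r (z : {perm 'Z_q * 'Z_Q}) : slope [~ z, 1] = 0%R by rewrite commg1.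
have sl1l (z : {perm 'Z_q * 'Z_Q}) : slope [~ 1, z] = 0%R by rewrite comm1g.
have sl12 := slope_parabola m_gt0.
have sl21 : slope [~ y2, y1] = (- 4%:R)%R :> 'Z_Q.
  have Lhl : [~ x h, x l] \in 'L_2(G) by rewrite lcn2 mem_commg ?nil_x_mem.
  apply/eqP; rewrite -addr_eq0 -sl12 addrC; apply/eqP.
  have fy1 : f (x h) = y1 by rewrite fx /y eqxx.
  have fy2 : f (x l) = y2 by rewrite fx /y eq_sym (negPf neq_hl) eqxx.
  rewrite -(invg_comm y1 y2) -/y1 -/y2 -fy1 -fy2 -morphR ?nil_x_mem // -morphV ?(GL _ 2) //.
  by rewrite -slM ?groupV // mulgV sl0 ?group1.
rewrite /y; case: (eqVneq i h) => [->|neq_ih]; case: (eqVneq j h) => [->|neq_jh] /=.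
- by rewrite sl11 !(negPf neq_hl) subrr mulr0.
- rewrite subr0; case: eqP => _; first by rewrite mulr1n mulr1z mulr1 sl12.
  by rewrite mulr0n mulr0z mulr0 sl1r.
- rewrite sub0r mulrNz mulrN; case: eqP => _; first by rewrite mulr1n mulr1z mulr1 sl21.
  by rewrite mulr0n mulr0z mulr0 oppr0 sl1l.
rewrite subrr mulr0z mulr0; do 2!case: eqP => _; by rewrite ?sl11 ?sl1r ?sl1l.
Qed.

Lemma nil_x_exp_leq N i : (forall j, inr j -> alpha j <= N) -> x i ^+ (p ^ N) = 1.
Proof.
move=> le_aN; rewrite /x; case: ifP => [ir|_]; last exact: expg1n.
have := nil_x_exp i; rewrite /x ir => x0E.
by rewrite -(subnKC (le_aN i ir)) expnD expgM x0E expg1n.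
Qed.

Lemma nil_central_step n c : 1 < n <= p -> c \in 'L_n(G) ->
  (forall i, commute c (x i)) -> c \in 'L_n.+1(G).
Proof.
case/andP=> n_gt1 le_np Lc cGc; have n_gt0 := ltnW n_gt1.
have [A [cl [clM cl0 cl_inj]]] := lcn_factor_zmod G n.
have defS s : s \in S -> exists i, s = x i by case/nil_genP=> i _ ->; exists i.
have [L sL cL] := lcn_word_span nil_x_mem nil_gen defS n_gt0 Lc.
apply: cl_inj => //; rewrite (lcn_transfer nil_x_mem clM cl0 n_gt0 Lc sL cL).
have r_gt0 := ltnW r_gt1.
have le_ar j : inr j -> alpha j <= alpha r by case/andP=> j_gt0 lejr; apply: alpha_mono.
have cl_exp v i e : size v = n -> i \in v -> x i ^+ e = 1 -> (cl (word_comm x v) *+ e = 0)%R.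
  by move=> sz_v vi xe; apply: (cl_word_exponent nil_x_mem clM cl0 sz_v vi xe).
apply: (dynkin_criterion nil_x_mem clM cl0 p_pr n_gt1 le_np (N := alpha r) _ sL) => [v sz_v | w sz_w].
  apply: (cl_exp v (head 0 v)) => //; last exact: nil_x_exp_leq.
  by rewrite -nth0 mem_nth // sz_v.
have [wR | /allPn[i wi ir]] := boolP (all inr w); last first.
  by have := cl_exp w i 1%N sz_w wi; rewrite /x (negPf ir) expg1 mulr1n => ->; rewrite ?mul0rz.
have [w_const | nconst] := boolP (all (pred1 (head 0 w)) w).
  by rewrite (word_comm_const x _ w_const) ?sz_w // cl0 ?group1 // mul0rz.
(* The letter of least order bounds the order of the commutator of [w]; the same p^m is a modulus
   over which all letters of [w] can be represented. *)
have [i0 wi0 min_i0] : exists2 i0, i0 \in w & forall j, j \in w -> alpha i0 <= alpha j.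
  have w0 : head 0 w \in w by rewrite -nth0 mem_nth // sz_w.
  have ex_m : exists m, has (fun i => alpha i == m) w.
    by exists (alpha (head 0 w)); apply/hasP; exists (head 0 w).
  case: (ex_minnP ex_m) => m0 /hasP[i0 wi0 /eqP <-] min_m0.
  by exists i0 => // j wj; apply: min_m0; apply/hasP; exists j.
set m := alpha i0; have m_gt0 : 0 < m by apply/alpha_gt0/(allP wR).
have q_gt1 : 1 < p ^ m by rewrite -(expn0 p) ltn_exp2l.
have clq : (cl (word_comm x w) *+ (p ^ m) = 0)%R by apply: cl_exp wi0 (nil_x_exp i0).
have [p_gt2 | le_p2] := ltnP 2 p.
  apply: (mulrz_Zp_eq0 (b := 1) _ q_gt1 clq) => //.
  rewrite mul1r mul1n.
  have sz : 1 < size w <= p by rewrite sz_w n_gt1.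
  have [j [u [wj def_u run]]] := word_extension p_gt2 sz nconst.
  have uw i : i \in u -> i \in w.
    by case: def_u => -[-> _]; rewrite ?mem_rcons inE => /predU1P[->|].
  apply: (nil_coef_zero m_gt0 _ sz_w Lc sL cL (cGc j) _ def_u); first by rewrite n_gt0.
    by apply/allP=> i /uw; apply: (allP wR).
  by apply: nil_dvd_run run => i /uw; apply: min_i0.
have p2 : p = 2 by apply/eqP; rewrite eqn_leq le_p2.
have n2 : n = 2 by apply/eqP; rewrite eqn_leq (leq_trans le_np le_p2).
(* The factor b = 4 is the slope of the commutator of the two test elements. *)
rewrite p2 in q_gt1 clq; apply: (mulrz_Zp_eq0 (b := 4) _ q_gt1 clq) => //.
rewrite n2 in Lc; rewrite n2 in cL; rewrite n2 in sL; rewrite n2 in sz_w.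
case: w sz_w wR nconst wi0 min_i0 {clq} => [|h [|l []]] //= _.
rewrite !andbT eqxx /= => /andP[hR lR] neq_lh _ min_i0.
apply: nil_coef_zero2 => //.
- by rewrite eq_sym.
- by apply: min_i0; rewrite mem_head.
- by apply: min_i0; rewrite !inE eqxx orbT.
- exact: Lc.
exact: cL.
Qed.

Lemma nil_central_lcn c : c \in 'L_2(G) -> (forall i, commute c (x i)) -> c \in 'L_p.+1(G).
Proof.
move=> Lc cGc; suff: forall k, k < p -> c \in 'L_k.+2(G).
  by move/(_ p.-1); rewrite prednK ?prime_gt0 // leqnn => /(_ isT).
elim=> // k IH ltkp; apply: nil_central_step => //; apply: IH; exact: ltnW.
Qed.

Lemma nil_prod_list g : g \in G -> exists2 l, all inr l & g = \prod_(i <- l) x i.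
Proof.
rewrite [in X in X -> _]nil_gen; elim/gen_ind: g / => [|g h _ _|_ /nil_genP[i ir ->]].
- by exists [::] => //; rewrite big_nil.
- move=> [l1 r1 ->] [l2 r2 ->]; exists (l1 ++ l2); last by rewrite big_cat.
  by rewrite all_cat r1.
by exists [:: i]; rewrite /= ?ir // big_seq1.
Qed.

(** When [u] is a run followed by a different letter, commutation kills the entry of g over the run,
    which is a binomial coefficient of an exponent sum. *)
Lemma nil_entry_zero m u w j l g : 0 < m -> g = \prod_(i <- l) x i ->
    (forall i, commute g (x i)) -> u = rcons w j -> 0 < size w <= p ->
    all inr u -> nth 0 w 0 <> j -> all (pred1 (nth 0 w 0)) w ->
    (forall i s t, i \in u -> s < t <= size u ->
       all (pred1 i) (drop s (take t u)) -> p ^ m %| 'C(E i, t - s)) ->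
  p ^ m %| 'C(count_mem (nth 0 w 0) l, size w).
Proof.
move=> m_gt0 def_g cGg def_u /andP[w_gt0 le_wp] uR neq_j w_const dvd_run.
have sz_u : size u = (size w).+1 by rewrite def_u size_rcons.
have [|q_gt1 [E_gt0 [run' [f uf fx]]]] := nil_matrix m_gt0 uR _ dvd_run.
  by rewrite sz_u.
have Gg : g \in G by rewrite def_g group_prod // => i _; apply: nil_x_mem.
have := comm_entry nil_x_mem fx sz_u Gg (cGg j).
have -> : nth 0 u (size w) = j by rewrite def_u nth_rcons ltnn eqxx.
have -> : nth 0 u 0 = nth 0 w 0 by rewrite def_u nth_rcons w_gt0.
have le_wu : size w <= size u by rewrite sz_u.
have all_w : all (pred1 (nth 0 w 0)) (drop 0 (take (size w) u)).
  by rewrite drop0 def_u -cats1 take_size_cat.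
rewrite eqxx (introF eqP neq_j) def_g (entry_prod nil_x_mem fx uf _ (leq0n _) le_wu all_w).
by rewrite subn0 => /eqP; rewrite Zp_natr_dvd.
Qed.

Lemma nil_central_pair m i j l g : g = \prod_(i <- l) x i -> (forall i, commute g (x i)) ->
    inr i -> inr j -> i != j -> 0 < m -> m <= alpha i -> m <= alpha j ->
  p ^ m %| count_mem i l.
Proof.
move=> def_g cGg ir jr neq_ij m_gt0 le_mi le_mj.
have := @nil_entry_zero m [:: i; j] [:: i] j l g m_gt0 def_g cGg.
rewrite /= bin1; apply=> //; rewrite ?prime_gt0 ?ir ?jr ?eqxx //; first exact/eqP.
apply: nil_dvd_run => [k|k s t]; first by rewrite !inE => /orP[] /eqP->.
apply: run_length_lt; rewrite //= ?ltnS ?prime_gt0 //; last by lia.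
by exists 0, 1%N; split=> //; rewrite prime_gt0.
Qed.

(** Either alpha_r = alpha_(r-1) and both sides are 1, even if the quotient is not exact, or p^(a+1)
    divides the exponent sum K: p^a divides both K and C(K, p). *)
Lemma nil_central_last l g : g = \prod_(i <- l) x i -> (forall i, commute g (x i)) ->
  (x r ^+ (p ^ (alpha r.-1).+1)) ^+ (count_mem r l %/ p ^ (alpha r.-1).+1) = x r ^+ count_mem r l.
Proof.
move=> def_g cGg; set K := count_mem r l; set a := alpha r.-1.
have r_gt0 := ltnW r_gt1.
have rr : inr r by rewrite /inr r_gt0 leqnn.
have rr1 : inr r.-1 by rewrite /inr leq_pred andbT -ltnS prednK.
have neq_r : r != r.-1 by rewrite gtn_eqF // ltn_predL.
have le_ar : a <= alpha r by apply: alpha_mono => //; [case/andP: rr1 | apply: leq_pred].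
have a_gt0 : 0 < a by apply: alpha_gt0.
have pK : p ^ a %| K by apply: (nil_central_pair def_g cGg rr rr1).
have [eq_a | lt_a] := leqP (alpha r) a.
  have xrK e : p ^ a %| e -> x r ^+ e = 1.
    case/dvdnP=> k ->; have /eqP eq_ra : alpha r == a by rewrite eqn_leq eq_a.
    by rewrite mulnC expgM -eq_ra nil_x_exp expg1n.
  by rewrite !xrK ?expg1n // expnSr dvdn_mulr.
suff : p ^ a.+1 %| K by move/divnK; rewrite -expgM mulnC => ->.
apply: dvdn_mul_of_dvdn_bin => //; first by apply: dvdn_trans pK; apply: dvdn_exp.
have := @nil_entry_zero a (rcons (nseq p r) r.-1) (nseq p r) r.-1 l g a_gt0 def_g cGg.
have p_gt0 := prime_gt0 p_pr.
rewrite size_nseq nth_nseq p_gt0; apply=> //; rewrite ?leqnn //.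
- by rewrite all_rcons rr1 all_nseq rr orbT.
- exact/eqP.
- by rewrite all_nseq /= eqxx orbT.
move=> i s t; rewrite size_rcons size_nseq mem_rcons inE mem_nseq p_gt0 /= => iu /andP[ltst let_] all_i.
have le_ai : a <= alpha i by case/orP: iu => /eqP->.
have [lt_p | ge_p] := ltnP (t - s) p.
  apply: (@dvdn_trans (p ^ alpha i)); first exact: dvdn_exp2l.
  by rewrite dvdn_bin_pexp // subn_gt0 ltst.
have nth_run k : s <= k < t -> nth 0 (rcons (nseq p r) r.-1) k = i.
  case/andP=> lesk ltkt; apply/eqP.
  have -> : nth 0 (rcons (nseq p r) r.-1) k
      = nth 0 (drop s (take t (rcons (nseq p r) r.-1))) (k - s).
    by rewrite nth_drop subnKC // nth_take.
  apply: (allP all_i); rewrite mem_nth // size_drop size_takel ?size_rcons ?size_nseq //.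
  by rewrite ltn_sub2r.
have les1 : s < p by lia.
have eq_ir : i = r by rewrite -(nth_run s) ?leqnn // nth_rcons size_nseq les1 nth_nseq les1.
have eq_p : t - s = p.
  (* The last letter differs from r, so the full initial run is the only one of length p; it
     requires p^a to divide C(p^(alpha_r), p), true as a < alpha_r. *)
  apply/eqP; rewrite eqn_leq ge_p andbT leqNgt; apply/negP=> lt_p.
  have := nth_run p; rewrite nth_rcons size_nseq ltnn eqxx eq_ir => eq_r.
  by case/eqP: neq_r; rewrite eq_r //; lia.
rewrite eq_p eq_ir /E; have def_r := ltn_predK lt_a; rewrite -def_r.
apply: (@dvdn_trans (p ^ (alpha r).-1)); last exact: dvdn_bin_pexp_p.
by rewrite dvdn_exp2l // -ltnS def_r.
Qed.

Lemma nil_center_sub g : g \in G -> (forall i, commute g (x i)) ->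
  (forall i, commute (x r ^+ (p ^ (alpha r.-1).+1)) (x i)) ->
  g \in <<[set x r ^+ (p ^ (alpha r.-1).+1)] :|: 'L_p.+1(G)>>.
Proof.
move=> Gg cGg czx; have [l lR def_g] := nil_prod_list Gg.
set z := x r ^+ _; pose w := x r ^+ count_mem r l.
have def_w : z ^+ (count_mem r l %/ p ^ (alpha r.-1).+1) = w := nil_central_last def_g cGg.
have r_gt0 := ltnW r_gt1.
have Gw : w \in G by rewrite groupX ?nil_x_mem.
have cwx i : commute w (x i).
  by rewrite -def_w; apply/commute_sym/commuteX/commute_sym/czx.
(* Modulo the derived subgroup g is the product of the powers of the x_i to their exponent sums; the
   factors with i different from r vanish, as their exponents are divisible by the order of x_i. *)
have Lc : w^-1 * g \in 'L_2(G).
  have [A [cl [clM cl0 cl_inj]]] := lcn_factor_zmod G 1.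
  rewrite lcn1 in clM cl_inj; apply: cl_inj; first by rewrite groupM ?groupV.
  have clV h : h \in G -> cl h^-1 = (- cl h)%R.
    by move=> Gh; apply/eqP; rewrite -addr_eq0 -clM ?groupV // mulVg cl0 ?group1.
  have clX h e : h \in G -> cl (h ^+ e) = (cl h *+ e)%R.
    move=> Gh; elim: e => [|e IH]; first by rewrite cl0 ?group1.
    by rewrite expgS clM ?groupX // IH mulrS.
  have cl_prod : cl g = (\sum_(i <- l) cl (x i))%R.
    rewrite def_g; have [] : \prod_(i <- l) x i \in G /\
      cl (\prod_(i <- l) x i) = (\sum_(i <- l) cl (x i))%R; last by [].
    elim/big_ind2: _ => [|u a v b [Gu <-] [Gv <-]|i _]; rewrite ?nil_x_mem //.
      by rewrite group1 cl0 ?group1.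
    by rewrite groupM // clM.
  rewrite clM ?groupV // clV // /w clX ?nil_x_mem // cl_prod.
  have -> : (\sum_(i <- l) cl (x i) = \sum_(i <- undup l) cl (x i) *+ count_mem i l)%R.
    by rewrite -[LHS]big_undup_iterop_count.
  have F0 i : i \in undup l -> i != r -> (cl (x i) *+ count_mem i l = 0)%R.
    rewrite mem_undup => li neq_ir; rewrite -clX ?nil_x_mem //.
    have /andP[i_gt0 leir] := allP lR i li.
    have ltir : i < r by rewrite ltn_neqAle neq_ir.
    have ir : inr i by rewrite /inr i_gt0.
    have rr : inr r by rewrite /inr r_gt0 leqnn.
    have := nil_central_pair def_g cGg ir rr neq_ir (alpha_gt0 ir) (leqnn _)
      (alpha_mono i_gt0 leir (leqnn r)).
    by case/dvdnP=> k ->; rewrite mulnC expgM nil_x_exp expg1n cl0 ?group1.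
  have [lr | l'r] := boolP (r \in undup l).
    rewrite (bigD1_seq r) ?undup_uniq //= big_seq_cond big1 ?addr0 ?addNr //.
    by move=> i /andP[li neq_ir]; apply: F0.
  rewrite big_seq big1 ?addr0 => [|i li].
    by rewrite mem_undup in l'r; rewrite (count_memPn l'r) mulr0n oppr0.
  by apply: F0 => //; apply: contraNneq l'r => <-.
have Lc2 : w^-1 * g \in 'L_p.+1(G).
  apply: nil_central_lcn Lc _ => i; apply/commute_sym/commuteM; last exact/commute_sym.
  exact/commuteV/commute_sym.
rewrite -[g](mulKVg w) groupM //; last by rewrite mem_gen // inE Lc2 orbT.
by rewrite -def_w groupX // mem_gen // inE set11.
Qed.

Lemma nil_pow_central i : commute (x r ^+ (p ^ (alpha r.-1).+1)) (x i).
Proof.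
rewrite {2}/x; case: ifP => [ir | _]; last exact: commute1.
have -> : x0 i = x i by rewrite /x ir.
have [-> | neq_ir] := eqVneq i r; first exact/commute_sym/commuteX.
have /andP[i_gt0 leir] := ir.
have ltir : i < r by rewrite ltn_neqAle neq_ir.
pose K := <[x i]> <*> <[x r]>.
have LK : 'L_p.+2(K) = 1.
  apply/trivgP; rewrite -nil_class_le lcnS // join_subG !cycle_subG !nil_x_mem //.
have le_a : alpha i <= alpha r.-1.
  by apply: alpha_mono => //; rewrite ?leq_pred // -ltnS prednK // ltnW.
have xa : x i ^+ (p ^ alpha r.-1) = 1.
  by rewrite -(subnKC le_a) expnD expgM nil_x_exp expg1n.
by apply/commgP/eqP; apply: (@commute_pow _ (<[x i]> <*> <[x r]>)%G p) LK xa.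
Qed.

End NilpotentProduct.

Theorem theorem2p4 (gT : finGroupType) (G : {group gT}) (p r : nat)
    (x : nat -> gT) (alpha : nat -> nat) :
  prime p -> 1 < r ->
  (forall i, 0 < i <= r -> 0 < alpha i) ->
  (forall i j, 0 < i -> i <= j -> j <= r -> alpha i <= alpha j) ->
  is_nil_prod p.+1 G r x (fun i => (p ^ alpha i)%N) ->
  'Z(G) = <<[set x r ^+ (p ^ (alpha r.-1).+1)%N] :|: 'L_p.+1(G)>>.
Proof.
move=> p_pr r_gt1 a_gt0 a_mono nilG.
pose x' i := if 0 < i <= r then x i else 1.
have x'r : x' r = x r by rewrite /x' leqnn ltnW.
have Gx' i : x' i \in G := nil_x_mem nilG i.
have cpow := nil_pow_central p_pr r_gt1 a_mono nilG.
apply/eqP; rewrite eqEsubset gen_subG; apply/andP; split.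
  apply/subsetP=> g /centerP[Gg cGg]; rewrite -x'r.
  by apply: (nil_center_sub p_pr r_gt1 a_gt0 a_mono nilG) => // i; apply: cGg; apply: Gx'.
rewrite subUset sub1set -x'r; apply/andP; split.
  apply/centerP; split; first by rewrite groupX ?Gx'.
  move=> g Gg; have [l _ ->] := nil_prod_list nilG Gg.
  by elim/big_ind: _ => [|u v cu cv|i _]; [exact: commute1 | exact: commuteM | exact: cpow].
rewrite subsetI lcn_sub /=; apply/commG1P/trivgP.
by rewrite -(nil_class_le nilG) lcnSnS.
Qed.
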